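(* Let $\lambda$ be a singular cardinal of uncountable cofinality such that $\square^*_\lambda$ holds, and let $\langle\lambda_i\mid i<\mathrm{cf}(\lambda)\rangle$ be the increasing enumeration of a club in $\lambda$. Then for every stationary $S\subseteq E^{\lambda^+}_{>\omega}$ there exists a transversal $\vec C=\langle C_\delta\mid\delta<\lambda^+\rangle$ for $\square^*_\lambda$ such that for every club $D\subseteq\lambda^+$ there is $\delta\in S$ such that for every $i<\min\{\delta,\mathrm{cf}(\lambda)\}$, $\sup(\mathrm{nacc}(C_\delta)\cap D\cap E^{\lambda^+}_{\ge\lambda_i})=\delta$.
   Context: For a set of ordinals $A$: $\mathrm{acc}(A)=\{\alpha\in A\mid\sup(A\cap\alpha)=\alpha>0\}$, $\mathrm{nacc}(A)=A\setminus\mathrm{acc}(A)$. $E^{\lambda^+}_{>\omega}=\{\alpha<\lambda^+\mid\mathrm{cf}(\alpha)>\omega\}$ and $E^{\lambda^+}_{\ge\mu}=\{\alpha<\lambda^+\mid\mathrm{cf}(\alpha)\ge\mu\}$. A $C$-sequence over $\lambda^+$ is $\langle C_\delta\mid\delta<\lambda^+\rangle$ with each $C_\delta$ a closed subset of $\delta$ with $\sup(C_\delta)=\sup(\delta)$; it is weakly coherent if for every $\alpha<\lambda^+$, $|\{C_\delta\cap\alpha\mid\delta<\lambda^+\}|<\lambda^+$. A transversal for $\square^*_\lambda$ is a weakly coherent $C$-sequence over $\lambda^+$ with $\mathrm{otp}(C_\delta)\le\lambda$ for all $\delta$. $\square^*_\lambda$ (weak square) asserts the existence of $\langle\mathcal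 C_\alpha\mid\alpha<\lambda^+\rangle$ such that for every limit $\alpha$, $1\le|\mathcal C_\alpha|\le\lambda$, each $C\in\mathcal C_\alpha$ is club in $\alpha$ of order type $\le\lambda$, and for every $C\in\mathcal C_\alpha$ and $\bar\alpha\in\mathrm{acc}(C)$, $C\cap\bar\alpha\in\mathcal C_{\bar\alpha}$. *)

(* Defs.v *)
From mathcomp Require Import all_boot all_order.
From mathcomp Require Import all_classical.

Set Implicit Arguments.
Unset Strict Implicit.
Unset Printing Implicit Defensive.

Local Open Scope order_scope.
Local Open Scope classical_set_scope.
Local Open Scope card_scope.

(* The ordinals are the elements of an arbitrary well-ordered type T, so that
   the ordinal a is identified with the set [below a] of its predecessors.
   All notions below depend only on the ordinals up to the ones mentioned, so
   T may be any initial segment of the ordinals containing them. *)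

Section Ordinals.
Context {d : Order.disp_t} {T : orderType d}.
Implicit Types (a b c l k : T) (A C D S : set T).

Definition below a : set T := [set b | b < a].

(* sup A = a is written [supremums A a]; thus the supremum of the empty set is
   the least ordinal, and sup a is the supremum of [below a]. *)

Definition acc A : set T :=
  [set a | [/\ A a, supremums (A `&` below a) a & below a !=set0]].

Definition nacc A : set T := A `\` acc A.

Definition limit_ord a : Prop := below a !=set0 /\ supremums (below a) a.

Definition least (P : set T) : set T := P `&` lbound P.

Definition is_omega a : Prop := least limit_ord a.

Definition gt_omega a : Prop := exists2 w, is_omega w & w < a.

Definition increasing_enum (f : T -> T) b A : Prop :=
  set_bij (below b) A f /\ {in below b &, {homo f : x y / x < y}}.

Definition has_otp A b : Prop := exists f : T -> T, increasing_enum f b A.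

(* A set of ordinals bounded by an element of T has an order type in T. *)
Definition otp_le A l : Prop := exists2 b, has_otp A b & b <= l.

Definition cofinal_in a A : Prop :=
  A `<=` below a /\ forall b, b < a -> exists2 c, A c & b <= c.

Definition cofinal_otps a : set T :=
  [set b | exists2 A, cofinal_in a A & has_otp A b].

(* The default value a of xget is never used: see cofP. *)
Definition cf a : T := xget a (least (cofinal_otps a)).

Definition closed_in a C : Prop :=
  C `<=` below a /\
  forall b, below b !=set0 -> b < a -> supremums (C `&` below b) b -> C b.

Definition club_in a C : Prop := closed_in a C /\ cofinal_in a C.

Definition stationary_in a S : Prop :=
  S `<=` below a /\ forall D, club_in a D -> S `&` D !=set0.

Definition card_lt (U V : Type) (A : set U) (B : set V) : Prop :=
  A #<= B /\ ~ (B #<= A).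

Definition is_cardinal a : Prop :=
  forall b, b < a -> card_lt (below b) (below a).

Definition is_succ_cardinal l k : Prop :=
  least [set m | is_cardinal m /\ l < m] k.

Definition singular l : Prop :=
  [/\ is_cardinal l, infinite_set (below l) & cf l < l].

Definition E_gt_omega k : set T := [set a | a < k /\ gt_omega (cf a)].

Definition E_ge k b : set T := [set a | a < k /\ b <= cf a].

(* Sequences indexed by the ordinals below k are total functions on T whose
   values outside [below k] are irrelevant. *)

Definition C_sequence k (C : T -> set T) : Prop :=
  forall a, a < k ->
    closed_in a (C a) /\ supremums (C a) = supremums (below a).

Definition weakly_coherent k (C : T -> set T) : Prop :=
  forall a, a < k ->
    card_lt [set C b `&` below a | b in below k] (below k).

(* In the next two definitions, k stands for the cardinal successor of l. *)

Definition weak_square_transversal l k (C : T -> set T) : Prop :=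
  [/\ C_sequence k C, weakly_coherent k C &
      forall a, a < k -> otp_le (C a) l].

Definition weak_square l k : Prop :=
  exists CC : T -> set (set T), forall a, a < k -> limit_ord a ->
    [/\ CC a !=set0, CC a #<= below l,
        (forall C, CC a C -> club_in a C /\ otp_le C l) &
        forall C b, CC a C -> acc C b -> CC b (C `&` below b)].

Lemma least_ex (P : set T) :
  wochoice.well_order (<=%O : rel T) -> P !=set0 -> least P !=set0.
Proof.
move=> wo [x Px].
have [|y [[Py ymin] _]] := wo (mem P); first by exists x; exact: mem_set.
exists y; split; first exact: set_mem.
by move=> z Pz; apply: ymin; exact: mem_set.
Qed.

Lemma cofP a :
  wochoice.well_order (<=%O : rel T) -> least (cofinal_otps a) (cf a).
Proof.
move=> wo; rewrite /cf; have /(least_ex wo)[c hc] : cofinal_otps a !=set0.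
  exists a, (below a); first by split=> // b ba; exists b.
  exists id; split=> //; split=> //; last by move=> b ba; exists b.
by case: xgetP => [y _ //|/(_ c)].
Qed.

End Ordinals.

(* Main.v *)
Require Import Defs.
From mathcomp Require Import all_boot all_order.
From mathcomp Require Import all_classical.

(* Weak square yields a weakly coherent C-sequence with otp(C_a) <= cf(a), since
   lambda is singular. Given a club D and a threshold h < lambda, walk down from
   delta to x: at each stage pass to the next point of the current C-set and
   lower it to the greatest element of D below it, continuing only through
   ordinals of cofinality at most h. The ordinals x reached form a closed subset
   of delta of cardinality at most max(|h|, cf(delta)), so each x of larger
   cofinality is a non-accumulation point of it; and the trace below y is
   computed from C_delta below y and finitely many steps, so weak coherence
   survives.

   If no such sequence guesses, the clubs witnessing the failures give a
   decreasing sequence (D_xi : xi <= lambda). For suitable delta in S, walks from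
   delta to points of D_lambda of cofinality >= i stabilize for xi < rho large,
   where cf(rho) > cf(delta), cf(lambda). A walk stopped at its first ordinal of
   cofinality >= i only passes finitely many ordinals of cofinality < i; as
   cf(lambda) > omega, a closure argument then gives one threshold that works for
   unboundedly many i. It can be chosen uniformly along delta if
   cf(delta) <> cf(lambda); otherwise the threshold is allowed to grow with the
   order type of C_delta below the target. At a large xi < rho this contradicts
   the failure of guessing for D_xi. *)

Set Implicit Arguments.
Unset Strict Implicit.
Unset Printing Implicit Defensive.

Import Order.TTheory.

Local Open Scope order_scope.
Local Open Scope classical_set_scope.
Local Open Scope card_scope.

(** * Cardinal arithmetic on a well-ordered type *)

Lemma card_le_inj (U V : Type) (A : set U) (B : set V) (f : U -> V) :
  (forall x, A x -> B (f x)) ->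
  (forall x y, A x -> A y -> f x = f y -> x = y) -> A #<= B.
Proof.
move=> fB fI; have /card_eqPle[_] : f @` A #= A.
  by apply: inj_card_eq => x y /set_mem Ax /set_mem Ay; exact: fI.
move=> /card_le_trans; apply; apply: subset_card_le => _ [x Ax <-]; exact: fB.
Qed.

Lemma card_le_inj_ex (U V : Type) (v0 : V) (A : set U) (B : set V) : A #<= B ->
  exists f : U -> V, (forall x, A x -> B (f x)) /\
    (forall x y, A x -> A y -> f x = f y -> x = y).
Proof.
elim/Ppointed: V => V in v0 B *; first by have := no v0.
move=> /pcard_leP[f]; exists f; split; first by move=> x Ax; exact: funS.
by move=> x y Ax Ay; apply: inj; exact: mem_set.
Qed.

(** Hilbert's hotel: for an injection [g] of the naturals into [A], send [a] to [g 0] and each [g n]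
    to [g n.+1], and fix all other points. *)
Lemma card_le_setU1 (U : Type) (A : set U) (a : U) :
  infinite_set A -> A `|` [set a] #<= A.
Proof.
move=> /infiniteP/(card_le_inj_ex a)[g [gA gI]].
have [Aa|nAa] := pselect (A a).
  by apply: subset_card_le => x [//|->].
pose h x := if pselect (x = a) then g 0%N else
  if pselect (exists n, x = g n) is left xg then g (projT1 (cid xg)).+1 else x.
have hg n : h (g n) = g n.+1.
  rewrite /h; case: pselect => [E|na]; first by case: nAa; rewrite -E; exact: gA.
  case: pselect => [xg|[]]; last by exists n.
  by case: (cid xg) => m E /=; rewrite (gI _ _ I I E).
have ha : h a = g 0%N by rewrite /h; case: pselect.
have hn x : x <> a -> (forall n, x <> g n) -> h x = x.
  rewrite /h => xa xg; case: pselect => // nxa; case: pselect => // -[n xE].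
  by case: (xg n).
have hP x : [\/ x = a, exists n, x = g n | [/\ h x = x, x <> a & forall n, x <> g n]].
  have [|xa] := pselect (x = a); first by constructor 1.
  have [|xg] := pselect (exists n, x = g n); first by constructor 2.
  have xg' n : x <> g n by move=> xE; apply: xg; exists n.
  by constructor 3; split=> //; exact: hn.
apply: (@card_le_inj _ _ _ _ h) => [x|x y].
  case: (hP x) => [->|[n ->]|[-> xa _] [|]] //; first by rewrite ha => _; exact: gA.
  by rewrite hg => _; exact: gA.
have hP2 := hP y; case: (hP x) hP2 => [->|[n ->]|[hx xa xg]] [->|[m ->]|[hy ya yg]] _ _ //.
- by rewrite ha hg => E; have := gI _ _ I I E.
- by rewrite ha hy => /esym /yg.
- by rewrite ha hg => E; have := gI _ _ I I E.
- by rewrite !hg => E; have [->] := gI _ _ I I E.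
- by rewrite hg hy => /esym /yg.
- by rewrite ha hx => /xg.
- by rewrite hg hx => /xg.
- by rewrite hx hy.
Qed.

(** Well-founded recursion as an equation between total functions: the recursive argument is cut
    down to the [R]-predecessors of [x] and takes the dummy value [v0] elsewhere, so no dependent
    types appear later. *)
Lemma wf_rec_ex (U V : Type) (R : U -> U -> Prop) (v0 : V)
    (G : U -> (U -> V) -> V) : well_founded R ->
  exists f : U -> V,
    forall x, f x = G x (fun y => if pselect (R y x) then f y else v0).
Proof.
move=> Rwf.
pose step x (rec : forall y, R y x -> V) :=
  G x (fun y => if pselect (R y x) is left Ryx then rec y Ryx else v0).
exists (Fix Rwf (fun=> V) step) => x; rewrite Fix_eq /step.
  by congr G; apply: funext => y; case: pselect.
move=> {}x f g fg; congr G; apply: funext => y.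
by case: pselect => // Ryx; rewrite fg.
Qed.

Section WellOrder.
Context {d : Order.disp_t} {T : orderType d}.
Hypothesis T_wo : wochoice.well_order (<=%O : rel T).
Implicit Types (a b c l k x y z nu : T) (A B C D S : set T).

Lemma least_exists A : A !=set0 -> exists2 x, A x & forall y, A y -> x <= y.
Proof. by move=> /(least_ex T_wo)[x [Ax xmin]]; exists x. Qed.

Lemma lt_wf : well_founded (fun x y : T => x < y).
Proof.
move=> x; apply: contrapT => nx.
have [|y ny ymin] := @least_exists [set y | ~ Acc (fun x y : T => x < y) y].
  by exists x.
apply: ny; constructor=> z zy; apply: contrapT => /ymin.
by rewrite leNgt zy.
Qed.

Lemma lt_ind (P : T -> Prop) :
  (forall x, (forall y, y < x -> P y) -> P x) -> forall x, P x.
Proof. by move=> IH; apply: (well_founded_ind lt_wf). Qed.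

(* The rank of u is the least ordinal that is not the rank of an R-predecessor
   of u; the hypothesis on the initial segments keeps the ranks below nu. *)
Lemma rank_exists (U : Type) (R : U -> U -> Prop) (A : set U) nu :
  well_founded R -> (forall u v w, R u v -> R v w -> R u w) ->
  (forall u, A u -> ~ (below nu #<= [set v | A v /\ R v u])) ->
  exists rk : U -> T,
    [/\ forall u, A u -> rk u < nu,
        forall u v, A u -> A v -> R u v -> rk u < rk v &
        forall u z, A u -> z < rk u -> exists v, [/\ A v, R v u & rk v = z]].
Proof.
move=> Rwf Rtr small.
have [rk rkE] := @wf_rec_ex U T R nu (fun u f =>
  xget nu (least [set z | ~ exists v, [/\ A v, R v u & f v = z]])) Rwf.
pose free u := [set z | ~ exists v, [/\ A v, R v u & rk v = z]].
have {}rkE u : rk u = xget nu (least (free u)).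
  rewrite rkE; congr (xget _ (least _)); apply: eq_set => z.
  apply: propext; split=> nz [v [Av Rvu vz]]; apply: nz; exists v; split=> //.
    by case: pselect.
  by move: vz; case: pselect.
have free_ex u : A u -> exists2 z, z < nu & free u z.
  move=> Au; apply: contrapT => nex; apply: (small u Au).
  apply: card_le_trans (card_image_le rk _); apply: subset_card_le => z znu.
  apply: contrapT => nz; apply: nex; exists z => // -[v [Av Rvu vz]].
  by apply: nz; exists v.
have rkP u : A u -> least (free u) (rk u).
  move=> /free_ex[z _ fz]; rewrite rkE; apply: xgetPex.
  by apply: least_ex => //; exists z.
exists rk; split.
- move=> u Au; have [z znu fz] := free_ex _ Au.
  by apply: le_lt_trans znu; have [_] := rkP _ Au; apply.
- move=> u v Au Av Ruv; have [fv _] := rkP _ Av; have [_ fu] := rkP _ Au.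
  rewrite lt_neqAle; apply/andP; split.
    by apply/eqP => E; apply: fv; exists u.
  apply: fu => -[w [Aw Rwu wE]]; apply: fv; exists w; split=> //.
  exact: Rtr Ruv.
- move=> u z Au zu; apply: contrapT => fz; have [_ fu] := rkP _ Au.
  by have := fu _ fz; rewrite leNgt zu.
Qed.

(** The rank function is strictly increasing, and totality of [R] makes it injective. *)
Lemma card_le_segments (U : Type) (R : U -> U -> Prop) (A : set U) nu :
  well_founded R -> (forall u v w, R u v -> R v w -> R u w) ->
  (forall u v, u = v \/ R u v \/ R v u) ->
  (forall u, A u -> ~ (below nu #<= [set v | A v /\ R v u])) ->
  A #<= below nu.
Proof.
move=> Rwf Rtr Rtot /(rank_exists Rwf Rtr)[rk [rknu rklt _]].
apply: (@card_le_inj _ _ _ _ rk) => // u v Au Av E.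
by case: (Rtot u v) => [//|[/(rklt _ _ Au Av)|/(rklt _ _ Av Au)]]; rewrite E ltxx.
Qed.

(** Gödel's well-ordering of pairs: by maximum, then lexicographically. *)
Definition pair_lt (p q : T * T) : Prop :=
  Order.max p.1 p.2 < Order.max q.1 q.2 \/
  (Order.max p.1 p.2 = Order.max q.1 q.2 /\
    (p.1 < q.1 \/ (p.1 = q.1 /\ p.2 < q.2))).

Lemma pair_lt_wf : well_founded pair_lt.
Proof.
suff H m a b : Order.max a b = m -> Acc pair_lt (a, b) by move=> [a b]; exact: H.
elim/lt_ind: m a b => m IHm a; elim/lt_ind: a => a IHa b.
elim/lt_ind: b => b IHb mE.
constructor=> -[a' b']; rewrite /pair_lt /= mE => -[lt_m|[E [lt_a|[aE lt_b]]]].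
- exact: (IHm _ lt_m _ _ erefl).
- by apply: IHa => //; rewrite -E.
- by rewrite aE in E *; apply: IHb.
Qed.

Lemma pair_lt_trans (p q r : T * T) : pair_lt p q -> pair_lt q r -> pair_lt p r.
Proof.
move: p q r => [a1 a2] [b1 b2] [c1 c2]; rewrite /pair_lt /=.
move=> [ab|[-> ab]] [bc|[E bc]].
- by left; exact: lt_trans bc.
- by left; rewrite -E.
- by left.
right; split=> //; case: ab bc => [ab|[-> ab]] [bc|[<- bc]].
- by left; exact: lt_trans bc.
- by left.
- by left.
- by right; split=> //; exact: lt_trans bc.
Qed.

Lemma pair_lt_total (p q : T * T) : p = q \/ pair_lt p q \/ pair_lt q p.
Proof.
case: p q => [a1 a2] [b1 b2]; rewrite /pair_lt /=.
have [lt|lt|->] := ltgtP (Order.max a1 a2) (Order.max b1 b2).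
- by right; left; left.
- by right; right; left.
have [lt|lt|->] := ltgtP a1 b1.
- by right; left; right; split=> //; left.
- by right; right; right; split=> //; left.
have [lt|lt|->] := ltgtP a2 b2; last by left.
- by right; left; right; split=> //; right.
- by right; right; right; split=> //; right.
Qed.

Lemma card_le_setX (U V U' V' : Type) (A : set U) (B : set V) (A' : set U')
    (B' : set V') : A #<= A' -> B #<= B' -> A `*` B #<= A' `*` B'.
Proof.
have [->|/set0P[u' Au']] := eqVneq A' set0.
  by move=> /card_le0P -> _; rewrite set0X.
have [->|/set0P[v' Bv']] := eqVneq B' set0.
  by move=> _ /card_le0P ->; rewrite setX0.
move=> /(card_le_inj_ex u')[f [fA fI]] /(card_le_inj_ex v')[g [gB gI]].
apply: (@card_le_inj _ _ _ _ (fun p => (f p.1, g p.2))) => [p [/fA ? /gB ?] //|].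
by move=> [a b] [a' b'] [/= Aa Bb] [/= Aa' Bb'] [/fI -> // /gI ->].
Qed.

(* Hessenberg: pairs are ordered by their maximum first, so that an initial
   segment of nu * nu lies in the square of a smaller ordinal. *)
Theorem card_square nu :
  infinite_set (below nu) -> below nu `*` below nu #<= below nu.
Proof.
elim/lt_ind: nu => nu IH nu_inf.
have [[m m_nu nu_m]|nu_card] :=
    pselect (exists2 m, m < nu & below nu #<= below m).
  have m_inf : infinite_set (below m) by apply: contra_not nu_inf; exact: card_le_finite.
  apply: card_le_trans (card_le_setX nu_m nu_m) _.
  apply: card_le_trans (IH _ m_nu m_inf) _; apply: subset_card_le => x.
  by move=> /lt_trans; exact.
apply: card_le_segments pair_lt_wf pair_lt_trans pair_lt_total _.
move=> [a b] [/= a_nu b_nu]; set m := Order.max a b.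
have m_nu : m < nu by rewrite gt_max a_nu.
pose M : set T := [set x | x <= m].
have seg_sub : [set q | (below nu `*` below nu) q /\ pair_lt q (a, b)] `<=` M `*` M.
  move=> [c e] [_]; rewrite /pair_lt /= -/m => cem.
  suff : Order.max c e <= m by rewrite ge_max => /andP[].
  by case: cem => [/ltW|[->]].
move=> nu_seg; have {seg_sub nu_seg}nu_MM := card_le_trans nu_seg (subset_card_le seg_sub).
have M_inf : infinite_set M.
  move=> M_fin; apply: nu_inf; apply: card_le_finite nu_MM _.
  exact: finite_setX.
(* Either the segment sits inside the square of some [m' < nu], where induction applies, or [nu] is
   the successor of [m] and has no more elements than [m]. *)
have [[m' mm' m'_nu]|m_max] := pselect (exists2 m', m < m' & m' < nu).
  have M_m' : M `<=` below m' by move=> x xm; exact: le_lt_trans mm'.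
  have m'_inf : infinite_set (below m') by apply: contra_not M_inf; exact: sub_finite_set.
  apply: nu_card; exists m' => //; apply: card_le_trans nu_MM _.
  apply: card_le_trans (IH _ m'_nu m'_inf).
  by apply: card_le_setX; exact: subset_card_le.
have nuE : below nu `<=` below m `|` [set m].
  move=> x xnu; case: (ltgtP x m) => [?|mx|->]; [by left| |by right].
  by case: m_max; exists x.
have m_inf : infinite_set (below m).
  move=> m_fin; apply: nu_inf; apply: sub_finite_set nuE _.
  by rewrite finite_setU; split=> //; exact: finite_set1.
apply: nu_card; exists m => //; apply: card_le_trans (subset_card_le nuE) _.
exact: card_le_setU1.
Qed.

Lemma infinite_below_le nu l :
  nu <= l -> infinite_set (below nu) -> infinite_set (below l).
Proof.
move=> nul; apply: contra_not; apply: sub_finite_set => x /lt_le_trans; exact.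
Qed.

Section CardinalBounds.
Context (nu : T) (nu_inf : infinite_set (below nu)).

Lemma card_le_nat : [set: nat] #<= below nu. Proof. exact/infiniteP. Qed.

(** Each point is coded by the index of one chosen set containing it and by its code in that set;
    the pairs are then absorbed by [card_square]. *)
Lemma card_le_bigcup (I U : Type) (P : set I) (F : I -> set U) :
  P #<= below nu -> (forall i, P i -> F i #<= below nu) ->
  \bigcup_(i in P) F i #<= below nu.
Proof.
move=> /(card_le_inj_ex nu)[f [fnu fI]] Fnu.
have /choice[g gP] : forall i, exists g : U -> T, P i ->
    (forall x : U, F i x -> below nu (g x)) /\
    (forall x y : U, F i x -> F i y -> g x = g y -> x = y).
  move=> i; have [/Fnu/(card_le_inj_ex nu)[g gP]|nP] := pselect (P i); last first.
    by exists (fun=> nu).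
  by exists g.
have [[i0 _]|nI] := pselect (exists i : I, P i); last first.
  rewrite (_ : \bigcup_(i in P) F i = set0) // -subset0 => x [i Pi _].
  by case: nI; exists i.
have /choice[j jP] : forall x : U, exists i, (\bigcup_(i in P) F i) x -> P i /\ F i x.
  move=> x; have [[i Pi Fx]|nF] := pselect ((\bigcup_(i in P) F i) x).
    by exists i.
  by exists i0.
apply: card_le_trans _ (card_square nu_inf).
apply: (@card_le_inj _ _ _ _ (fun x : U => (f (j x), g (j x) x))) => [x|x y].
  by move=> /jP[Pj Fj]; split; [exact: fnu|exact: (gP _ Pj).1].
move=> /jP[Px Fx] /jP[Py Fy] [/fI E]; have {}E := E Px Py.
by move: Fx; rewrite E => Fx; apply: (gP _ Py).2.
Qed.

Lemma card_le_setU (U : Type) (A B : set U) :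
  A #<= below nu -> B #<= below nu -> A `|` B #<= below nu.
Proof.
move=> A_le B_le; rewrite -bigcup2E; apply: card_le_bigcup.
  exact: card_le_trans (card_leT _) card_le_nat.
by move=> [|[|n]] _ //=.
Qed.

Lemma card_le_set1 (U : Type) (u : U) : [set u] #<= below nu.
Proof.
have [x nux] := infinite_setN0 nu_inf.
by apply: (@card_le_inj _ _ _ _ (fun=> x)) => // ? ? -> ->.
Qed.

End CardinalBounds.

End WellOrder.

(** * Limit points, order types and cofinality *)

Section LimitPoints.
Context {d : Order.disp_t} {T : orderType d}.
Implicit Types (a b c l k x y z nu : T) (A B C D S : set T).

Definition lim_of A y : Prop :=
  below y !=set0 /\ forall b, b < y -> exists2 c, A c & b < c /\ c < y.

Lemma supremums_limP A y :
  below y !=set0 -> supremums (A `&` below y) y <-> lim_of A y.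
Proof.
move=> y0; split=> [[_ ymin]|[_ Ay]]; last first.
  split=> [x [_ /ltW//]|z zub]; rewrite leNgt; apply/negP => /Ay[c Ac [zc cy]].
  by have := zub c (conj Ac cy); rewrite leNgt zc.
split=> // b b_y; apply: contrapT => nc.
have /ymin : ubound (A `&` below y) b.
  move=> x [Ax xy]; rewrite leNgt; apply/negP => bx; apply: nc.
  by exists x.
by rewrite leNgt b_y.
Qed.

Lemma accE A y : acc A y <-> A y /\ lim_of A y.
Proof.
split=> [[Ay /supremums_limP h y0]|[Ay yA]]; first by split=> //; exact: h.
by split=> //; [apply/supremums_limP => //; case: yA|case: yA].
Qed.

Lemma naccP A y : A y -> ~ lim_of A y -> nacc A y.
Proof. by move=> Ay nA; split=> // /accE[]. Qed.

Lemma closed_inE a C :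
  closed_in a C <-> C `<=` below a /\ forall b, b < a -> lim_of C b -> C b.
Proof.
split=> -[Ca Ccl]; split=> // b.
  by move=> ba bC; apply: Ccl => //; [case: bC|apply/supremums_limP => //; case: bC].
by move=> b0 ba /supremums_limP-/(_ b0); exact: Ccl.
Qed.

Lemma lim_ofS A B y : A `<=` B -> lim_of A y -> lim_of B y.
Proof. by move=> AB [y0 yA]; split=> // b /yA[c /AB]; exists c. Qed.

Lemma lim_ofN A y : below y !=set0 -> ~ lim_of A y ->
  exists2 b, b < y & forall c, A c -> c < y -> c <= b.
Proof.
move=> y0 nA; apply: contrapT => nb; apply: nA; split=> // b b_y.
apply: contrapT => nc; apply: nb; exists b => // c Ac cy; rewrite leNgt.
by apply/negP => bc; apply: nc; exists c.
Qed.

Lemma supremums_cofinal a A :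
  cofinal_in a A -> supremums A = supremums (below a).
Proof.
move=> [Aa Acof]; suff E : ubound A = ubound (below a) by rewrite /supremums E.
apply/seteqP; split=> z zub x Ax; last by apply: zub; exact: Aa.
by have [c Ac xc] := Acof _ Ax; exact: le_trans xc (zub _ Ac).
Qed.

Lemma limit_ordP a : limit_ord a <-> lim_of setT a.
Proof.
split=> [[a0 aS]|aL]; first by apply/supremums_limP => //; rewrite setTI.
have a0 : below a !=set0 by case: aL.
by split=> //; rewrite -[below a]setTI; apply/supremums_limP.
Qed.

End LimitPoints.

Section OrderTypes.
Context {d : Order.disp_t} {T : orderType d}.
Hypothesis T_wo : wochoice.well_order (<=%O : rel T).
Implicit Types (a b c l k x y z nu : T) (A B C D S : set T).

(** An upper bound on the order type that passes directly to subsets and to monotone images;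
    [otp_leP] shows that it agrees with [otp_le]. *)
Definition embeds A b : Prop := exists r : T -> T,
  (forall x, A x -> r x < b) /\ {in A &, {homo r : x y / x < y}}.

Lemma embedsS A B b : A `<=` B -> embeds B b -> embeds A b.
Proof.
move=> AB [r [rb rlt]]; exists r; split=> [x /AB|x y /set_mem/AB Bx /set_mem/AB By].
  exact: rb.
by apply: rlt; exact: mem_set.
Qed.

Lemma embeds_le A b c : b <= c -> embeds A b -> embeds A c.
Proof. by move=> bc [r [rb rlt]]; exists r; split=> // x /rb /lt_le_trans; exact. Qed.

Lemma embeds_card A b : embeds A b -> A #<= below b.
Proof.
move=> [r [rb rlt]]; apply: (@card_le_inj _ _ _ _ r) => // x y Ax Ay E.
have [xy|yx|//] := ltgtP x y.
  by have := rlt _ _ (mem_set Ax) (mem_set Ay) xy; rewrite E ltxx.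
by have := rlt _ _ (mem_set Ay) (mem_set Ax) yx; rewrite E ltxx.
Qed.

Lemma embeds_image A b (g : T -> T) :
  {in A &, {homo g : x y / x <= y}} -> embeds A b -> embeds (g @` A) b.
Proof.
move=> gle [r [rb rlt]].
have /choice[h hP] : forall z, exists x, (g @` A) z -> A x /\ g x = z.
  by move=> z; have [[x Ax <-]|nz] := pselect ((g @` A) z); [exists x|exists z].
exists (r \o h); split=> [z /hP[Ah _]|z z' /set_mem/hP[Az zE] /set_mem/hP[Az' zE'] zz'].
  exact: rb.
apply: rlt; try exact: mem_set.
rewrite ltNge; apply/negP => /(gle _ _ (mem_set Az') (mem_set Az)).
by rewrite zE zE' leNgt zz'.
Qed.

(** The value is meaningful only when [A] embeds in some element of [T]; [b0] is a mere default. *)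
Definition otp b0 A : T := xget b0 (least (embeds A)).

Section Otp.
Context (b0 : T).
Local Notation otp := (otp b0).

Lemma otp_embeds A b : embeds A b -> embeds A (otp A) /\ otp A <= b.
Proof.
move=> Ab; have [] : least (embeds A) (otp A).
  by apply: xgetPex; apply: least_ex => //; exists b.
by move=> Ao omin; split=> //; exact: omin.
Qed.

Lemma otpS A B b : A `<=` B -> embeds B b -> otp A <= otp B.
Proof.
move=> AB /otp_embeds[Bo _].
by have [] := otp_embeds (embedsS AB Bo).
Qed.

Lemma otp_seg_lt A b x : embeds A b -> A x -> otp (A `&` below x) < otp A.
Proof.
move=> /otp_embeds[[r [rb rlt]] _] Ax; apply: le_lt_trans (rb _ Ax).
suff /otp_embeds[] : embeds (A `&` below x) (r x) by [].
exists r; split=> [y [Ay yx]|y z /set_mem[Ay _] /set_mem[Az _]].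
  by apply: rlt => //; exact: mem_set.
by apply: rlt; exact: mem_set.
Qed.

Lemma otp_seg_homo A b x y :
  embeds A b -> A x -> x < y -> otp (A `&` below x) < otp (A `&` below y).
Proof.
move=> Ab Ax xy.
rewrite (_ : A `&` below x = (A `&` below y) `&` below x).
  by apply: (@otp_seg_lt _ b) => //; apply: embedsS Ab => ? [].
rewrite -setIA; congr (_ `&` _); apply/seteqP; split=> [z zx|z []//].
by split=> //; exact: lt_trans xy.
Qed.

(** If [z] were never the type of a proper segment, then by induction all these types would stay
    below [z]. They would embed [A] in [z], against the minimality of [otp A]. *)
Lemma otp_seg_surj A b z : embeds A b -> z < otp A ->
  exists2 x, A x & otp (A `&` below x) = z.
Proof.
move=> Ab z_otp; apply: contrapT => nx.
have nz x : A x -> otp (A `&` below x) != z.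
  by move=> Ax; apply/eqP => xz; apply: nx; exists x.
have homo x y : A x -> x < y -> otp (A `&` below x) < otp (A `&` below y).
  exact: otp_seg_homo Ab.
suff /otp_embeds[_] : embeds A z by rewrite leNgt z_otp.
exists (fun x => otp (A `&` below x)); split; last first.
  by move=> x y /set_mem Ax _; exact: homo.
elim/(lt_ind T_wo) => x IH Ax; rewrite lt_neqAle nz //=.
suff /otp_embeds[] : embeds (A `&` below x) z by [].
exists (fun y => otp (A `&` below y)); split=> [y [Ay yx]|y y' /set_mem[Ay _] _].
  exact: IH.
exact: homo.
Qed.

Lemma otp_leP A b : otp_le A b <-> embeds A b.
Proof.
split=> [[c [f [[fA fI fS] flt]] cb]|Ab].
  apply: embeds_le cb _.
  have /choice[r rP] : forall x, exists j, A x -> j < c /\ f j = x.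
    move=> x; have [Ax|nA] := pselect (A x); last by exists x.
    by have [j jc <-] := fS _ Ax; exists j.
  exists r; split=> [x /rP[]//|x y /set_mem/rP[xc xE] /set_mem/rP[yc yE] xy].
  rewrite ltNge; apply/negP; rewrite le_eqVlt => /predU1P[E|].
    by move: xy; rewrite -xE -yE E ltxx.
  move=> /(flt _ _ (mem_set yc) (mem_set xc)); rewrite xE yE => yx.
  by have := lt_trans xy yx; rewrite ltxx.
have [_ ob] := otp_embeds Ab; exists (otp A) => //.
have /choice[f fP] : forall z, exists x, z < otp A ->
    A x /\ otp (A `&` below x) = z.
  move=> z; have [/(otp_seg_surj Ab)[x Ax xz]|nz] := pselect (z < otp A).
    by exists x.
  by exists z.
have flt : {in below (otp A) &, {homo f : x y / x < y}}.
  move=> z z' /set_mem/fP[Az zE] /set_mem/fP[Az' zE'] zz'.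
  rewrite ltNge; apply/negP; rewrite le_eqVlt => /predU1P[E|].
    by move: zz'; rewrite -zE -zE' E ltxx.
  move=> /(otp_seg_homo Ab Az'); rewrite zE zE' => z'z.
  by have := lt_trans zz' z'z; rewrite ltxx.
exists f; split=> //; split.
- by move=> z /fP[].
- move=> z z' /set_mem zA /set_mem z'A E.
  by have [_ <-] := fP _ zA; have [_ <-] := fP _ z'A; rewrite E.
move=> x Ax; exists (otp (A `&` below x)); first exact: otp_seg_lt Ab Ax.
have [Ay yE] := fP _ (otp_seg_lt Ab Ax).
have [xy|yx|//] := ltgtP (f (otp (A `&` below x))) x.
  by have := otp_seg_homo Ab Ay xy; rewrite yE ltxx.
by have := otp_seg_homo Ab Ax yx; rewrite yE ltxx.
Qed.

End Otp.

(** The rank of a point for the order of [A] stays below [nu], since each proper segment is too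
    small to receive an injection of [nu]. *)
Lemma embeds_of_segments A nu :
  (forall x, A x -> exists2 m : T, card_lt (below m) (below nu) & A `&` below x #<= below m) ->
  embeds A nu.
Proof.
move=> small.
have [|u v w|x Ax|rk [rknu rklt _]] :=
    @rank_exists _ _ T_wo T (fun x y => x < y) A nu.
- exact: lt_wf.
- exact: lt_trans.
- have [m [_ nm] xm] := small _ Ax.
  by move=> /card_le_trans/(_ xm).
exists rk; split=> // x y /set_mem Ax /set_mem Ay; exact: rklt.
Qed.

Lemma embeds_cf_cofinal a : exists2 A, cofinal_in a A & embeds A (cf a).
Proof.
have [[A Aa Ao] _] := cofP a T_wo; exists A => //.
by apply/(otp_leP a); exists (cf a).
Qed.

(* The g-records of A, for an injection g into nu, form a cofinal set on which g
   is increasing. *)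
Lemma cf_le_card a A nu : cofinal_in a A -> A #<= below nu -> cf a <= nu.
Proof.
move=> [Aa Acof] /(card_le_inj_ex nu)[g [gnu gI]].
pose B : set T := [set x | A x /\ forall y, A y -> g y < g x -> y < x].
have /(otp_leP a)[c Bc cnu] : embeds B nu.
  exists g; split=> [x [Ax _]|x y /set_mem[Ax xr] /set_mem[Ay yr] xy].
    exact: gnu.
  rewrite ltNge; apply/negP; rewrite le_eqVlt => /predU1P[/gI E|].
    by move: xy; rewrite E // ltxx.
  by move=> /(xr _ Ay) yx; have := lt_trans xy yx; rewrite ltxx.
apply: le_trans cnu; have [_] := cofP a T_wo; apply; exists B => //.
split=> [x [/Aa]//|b ba].
have [|_ [x [Ax bx] <-] xmin] := @least_exists _ _ T_wo (g @` [set x | A x /\ b <= x]).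
  by have [x Ax bx] := Acof _ ba; exists (g x), x.
exists x => //; split=> // y Ay yx; rewrite ltNge; apply/negP => xy.
have := xmin (g y); rewrite leNgt yx => /(_ _)/negP; apply=> //.
by exists y => //; split=> //; exact: le_trans xy.
Qed.

Lemma bounded_of_card a A nu : A `<=` below a -> A #<= below nu -> nu < cf a ->
  exists2 b, b < a & forall c, A c -> c < b.
Proof.
move=> Aa Anu nucf; apply: contrapT => nb.
suff : cf a <= nu by rewrite leNgt nucf.
apply: cf_le_card Anu; split=> // b ba; apply: contrapT => nc.
apply: nb; exists b => // c Ac; rewrite ltNge; apply/negP => bc.
by apply: nc; exists c.
Qed.

(** Otherwise [A] below [x] would be a segment below some [b < x] plus at most one point, or a union
    of at most [nu] sets of size at most [nu]. This is the source of all points of large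
    cofinality. *)
Lemma cf_gt_of_card A nu x : infinite_set (below nu) ->
  (forall y, y < x -> A `&` below y #<= below nu) ->
  ~ (A `&` below x #<= below nu) -> lim_of A x /\ nu < cf x.
Proof.
move=> nu_inf small big; split.
  apply: contrapT => /lim_ofN[|b bx bmax].
    apply/set0P; apply: contra_notN big => /eqP E.
    by rewrite E setI0; exact: card_ge0.
  apply: big; apply: card_le_trans (card_le_setU T_wo nu_inf (small _ bx)
    (card_le_set1 nu_inf b)).
  apply: subset_card_le => c [Ac /(bmax _ Ac)].
  by rewrite le_eqVlt => /predU1P[->|cb]; [right|left].
rewrite ltNge; apply/negP => cfnu; apply: big.
have [B [Bx Bcof] /(embeds_le cfnu)/embeds_card Bnu] := embeds_cf_cofinal x.
apply: (@card_le_trans _ _ _ (\bigcup_(y in B) ((A `&` below y) `|` [set y]))).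
  apply: subset_card_le => c [Ac /Bcof[y By]].
  by rewrite le_eqVlt => /predU1P[->|cy]; exists y => //; [right|left].
apply: card_le_bigcup => // y By; apply: card_le_setU => //.
  by apply: small; exact: Bx.
exact: card_le_set1.
Qed.

Lemma cf_le a nu : below a #<= below nu -> cf a <= nu.
Proof. by apply: cf_le_card; split=> // b ba; exists b. Qed.

(** If [cf a] were [l], an enumeration of a cofinal subset of [a] in type [l], restricted to a
    cofinal subset of [l] of type [cf l], would give [cf a <= cf l < l]. *)
Lemma cf_below_singular l a : cf l < l -> below a #<= below l -> cf a < l.
Proof.
move=> lsing al; rewrite lt_neqAle cf_le // andbT; apply/eqP => cfE.
have [[A [Aa Acof]]] := cofP a T_wo; rewrite cfE => -[f [[fA fI fS] flt]] _.
have [L [Ll Lcof] /embeds_card Lcf] := embeds_cf_cofinal l.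
suff : cf a <= cf l by rewrite cfE leNgt lsing.
apply: (@cf_le_card _ (f @` L)); last first.
  exact: card_le_trans (card_image_le _ _) Lcf.
split=> [_ [j /Ll jl <-]|b /Acof[c /fS[j jl <-] bj]]; first by apply: Aa; exact: fA.
have [i Li ji] := Lcof _ jl; exists (f i); first by exists i.
apply: le_trans bj _; move: ji; rewrite le_eqVlt => /predU1P[->//|ji].
by apply: ltW; apply: flt => //; apply: mem_set => //; exact: Ll.
Qed.

End OrderTypes.

(** * Clubs in a successor cardinal *)

Section SuccessorCardinal.
Context {d : Order.disp_t} {T : orderType d}.
Hypothesis T_wo : wochoice.well_order (<=%O : rel T).
Implicit Types (a b c l k x y z nu : T) (A B C D S : set T).

(** The point [x] is the supremum of [b], [f b], [f (f b)], and so on; it stays below [k] because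
    [cf k] is uncountable. *)
Lemma sup_iterates k nu (f : T -> T) b :
  infinite_set (below nu) -> nu < cf k -> (forall a, a < k -> a < f a /\ f a < k) ->
  b < k -> exists2 x, b < x /\ x < k &
    forall c, c < x -> exists e, [/\ c <= e, b <= e, e < x & f e < x].
Proof.
move=> nu_inf nu_cf f_incr bk; pose s n := iter n f b.
have sk n : s n < k by elim: n => //= n /f_incr[].
have sS n : s n < s n.+1 by have [] := f_incr _ (sk n).
have bs n : b <= s n by elim: n => // n /le_trans; apply; exact: ltW.
have [|//|x0 x0k x0s] := @bounded_of_card _ _ T_wo k (range s) nu _ _ nu_cf.
- by move=> _ [n _ <-]; exact: sk.
- apply: card_le_trans (card_image_le _ _) _; exact: card_le_nat.
have [|x xs xmin] := @least_exists _ _ T_wo [set x | forall n, s n < x].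
  by exists x0 => n; apply: x0s; exists n.
exists x.
  split; first exact: (xs 0%N).
  by apply: le_lt_trans x0k; apply: xmin => n; apply: x0s; exists n.
move=> c cx; have [n cn] : exists n, c <= s n.
  apply: contrapT => nn; have : x <= c; last by rewrite leNgt cx.
  by apply: xmin => n; rewrite ltNge; apply/negP => cn; apply: nn; exists n.
by exists (s n); split=> //; exact: (xs n.+1).
Qed.

Context (l k : T) (l_card : is_cardinal l) (l_inf : infinite_set (below l)).
Hypothesis kP : is_succ_cardinal l k.

Lemma lt_succ_cardinal : l < k. Proof. by have [[]] := kP. Qed.

(** The least [m] with at least as many predecessors as [a] is a cardinal; if it exceeded [l], it
    would be at least [k], although [m <= a < k]. *)
Lemma card_below_succ_cardinal a : a < k -> below a #<= below l.
Proof.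
move=> ak.
have [|m am mmin] := @least_exists _ _ T_wo [set m | below a #<= below m].
  by exists a; exact: card_lexx.
have m_card : is_cardinal m.
  move=> b bm; split; first by apply: subset_card_le => x /lt_trans; exact.
  by move=> mb; have := mmin b (card_le_trans am mb); rewrite leNgt bm.
have ml : m <= l.
  rewrite leNgt; apply/negP => lm; have [_ kmin] := kP.
  have : k <= m by apply: kmin.
  by rewrite leNgt (le_lt_trans _ ak) // mmin //=; exact: card_lexx.
by apply: card_le_trans am _; apply: subset_card_le => x /lt_le_trans; exact.
Qed.

Lemma cf_succ_cardinal : l < cf k.
Proof.
have [] // := @cf_gt_of_card _ _ T_wo setT l k l_inf.
  by move=> y yk; rewrite setTI; exact: card_below_succ_cardinal.
by rewrite setTI; have [[k_card lk] _] := kP; have [] := k_card _ lk.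
Qed.

Lemma bounded_succ_cardinal A : A `<=` below k -> A #<= below l ->
  exists2 b, b < k & forall c, A c -> c < b.
Proof. by move=> Ak Al; apply: bounded_of_card Ak Al cf_succ_cardinal. Qed.

Lemma club_inE D : club_in k D <->
  [/\ D `<=` below k, forall b, b < k -> lim_of D b -> D b &
      forall b, b < k -> exists2 c, D c & b < c].
Proof.
split=> [[/closed_inE[Dk Dcl] [_ Dcof]]|[Dk Dcl Dunb]].
  split=> // b bk.
  have [||b' b'k bb'] := @bounded_succ_cardinal [set b].
  - by move=> _ ->.
  - exact: card_le_set1.
  by have [c Dc b'c] := Dcof _ b'k; exists c => //; apply: lt_le_trans b'c; exact: bb'.
split; first exact/closed_inE.
by split=> // b /Dunb[c Dc /ltW bc]; exists c.
Qed.

Lemma club_lim A : (forall b, b < k -> exists2 c, A c & b < c < k) ->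
  club_in k [set x | x < k /\ lim_of A x].
Proof.
move=> Aunb; apply/club_inE; split=> [x []//|b bk [b0 blim]|b bk].
  split=> //; split=> // c /blim[x [_ [_ xA]] [cx xb]].
  have [y Ay [cy yx]] := xA _ cx.
  by exists y => //; split=> //; exact: lt_trans xb.
have /choice[f fP] : forall a, exists c, a < k -> A c /\ a < c < k.
  move=> a; have [/Aunb[c Ac ac]|nk] := pselect (a < k); first by exists c.
  by exists a.
have [|x [bx xk] xP] := sup_iterates l_inf cf_succ_cardinal _ bk (f := f).
  by move=> a /fP[_ /andP[]].
exists x => //; split=> //; split; first by exists b.
move=> c /xP[e [ce _ ex fex]]; have [Ae /andP[ef _]] := fP _ (lt_trans ex xk).
by exists (f e) => //; split=> //; exact: le_lt_trans ef.
Qed.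

(** For unboundedness, [f a] is chosen so large that every [D i] has a point between [a] and [f a];
    the supremum of the iterates of [f] is then a limit of every [D i]. *)
Lemma club_bigcap (I : Type) (P : set I) (D : I -> set T) :
  P #<= below l -> (forall i, P i -> club_in k (D i)) ->
  club_in k (below k `&` \bigcap_(i in P) D i).
Proof.
move=> Pl Dclub; apply/club_inE; split=> [x []//|b bk bD|b bk].
  split=> // i Pi; have /club_inE[_ Dcl _] := Dclub _ Pi.
  by apply: Dcl => //; apply: lim_ofS bD => x [_]; exact.
have /choice[f fP] : forall a, exists a', a < k ->
    [/\ a < a', a' < k & forall i, P i -> exists2 c, D i c & a < c < a'].
  move=> a; have [ak|nk] := pselect (a < k); last by exists a.
  have /choice[n nP] : forall i, exists c, P i -> D i c /\ a < c.
    move=> i; have [Pi|nPi] := pselect (P i); last by exists a.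
    have /club_inE[_ _ /(_ _ ak)[c Dc ac]] := Dclub _ Pi.
    by exists c.
  have [||a' a'k a'P] := @bounded_succ_cardinal (n @` P `|` [set a]).
  - move=> _ [[i Pi <-]|->//]; have [Dn _] := nP _ Pi.
    by have /club_inE[Dk _ _] := Dclub _ Pi; exact: Dk.
  - apply: card_le_setU => //; last exact: card_le_set1.
    exact: card_le_trans (card_image_le _ _) Pl.
  exists a' => _; split=> //; first by apply: a'P; right.
  move=> i Pi; have [Dn an] := nP _ Pi; exists (n i) => //; rewrite an /=.
  by apply: a'P; left; exists i.
have [|x [bx xk] xP] := sup_iterates l_inf cf_succ_cardinal _ bk (f := f).
  by move=> a /fP[].
exists x => //; split=> // i Pi; have /club_inE[_ Dcl _] := Dclub _ Pi.
apply: Dcl => //; split; first by exists b.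
move=> c /xP[e [ce _ ex fex]]; have [_ _ fD] := fP _ (lt_trans ex xk).
have [y Dy /andP[ey yf]] := fD _ Pi.
by exists y => //; split; [exact: le_lt_trans ey|exact: lt_trans fex].
Qed.

Lemma club_setI A B : club_in k A -> club_in k B -> club_in k (A `&` B).
Proof.
move=> Aclub Bclub.
have [Ak _ _] := (club_inE A).1 Aclub.
suff -> : A `&` B = below k `&` \bigcap_(i in [set: bool]) (if i then A else B).
  apply: club_bigcap => [|[]//].
  apply: card_le_trans (card_le_nat l_inf); apply/pcard_injP.
  by exists (fun b : bool => nat_of_bool b) => -[] [].
apply/seteqP; split=> x; first by move=> [Ax Bx]; split; [exact: Ak|case].
by move=> [_ h]; split; [exact: (h true)|exact: (h false)].
Qed.

(** The witness is the least [x] below which [D] has more than [nu] points above [b]. It exists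
    because otherwise this part of [D] would have at most [l] points while being cofinal in [k]. *)
Lemma unbounded_cf_gt D nu b : club_in k D -> infinite_set (below nu) -> nu < l -> b < k ->
  exists2 c, D c & [/\ b < c, c < k & nu < cf c].
Proof.
move=> Dclub nu_inf nu_l bk; have /club_inE[Dk Dcl Dunb] := Dclub.
pose A := D `&` [set x | b < x].
have [|x [xk xbig] xmin] :=
    @least_exists _ _ T_wo [set x | x < k /\ ~ (A `&` below x #<= below nu)].
  apply: contrapT => nx.
  have small x : x < k -> A `&` below x #<= below nu.
    by move=> xk; apply: contrapT => xbig; apply: nx; exists x.
  have : cf k <= l; last by rewrite leNgt cf_succ_cardinal.
  apply: (@cf_le_card _ _ T_wo _ A); last first.
    apply: (card_le_segments T_wo (lt_wf T_wo)) => [x y z||x [/Dk xk _]].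
    - exact: lt_trans.
    - move=> x y; have [xy|yx|->] := ltgtP x y; [by right; left| |by left].
      by right; right.
    - move=> /card_le_trans/(_ (small _ xk)).
      by have [_] := l_card nu_l.
  split=> [x [/Dk]//|x xk].
  have [|c Dc xc] := Dunb (Order.max b x); first by rewrite gt_max bk.
  move: xc; rewrite gt_max => /andP[bc xc]; exists c => //; exact: ltW.
have [||xA nu_cf] := @cf_gt_of_card _ _ T_wo A nu x nu_inf.
- move=> y yx; apply: contrapT => ybig.
  have := xmin y; rewrite leNgt yx => /(_ _)/negP; apply=> //.
  by split=> //; exact: lt_trans xk.
- exact: xbig.
have Dx : D x by apply: Dcl => //; apply: lim_ofS xA => ? [].
exists x => //; split=> //.
have [[y yx] h] := xA; have [c [_ bc] [_ cx]] := h _ yx; exact: lt_trans cx.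
Qed.

(** Applied twice in the main argument: [delta] becomes a limit of points of high cofinality, each
    of which is a limit of points of the club of high cofinality. *)
Definition high_limits D : set T :=
  [set x | x < k /\ forall nu, nu < l -> lim_of (D `&` [set y | nu < cf y]) x].

Lemma club_high_limits D w : infinite_set (below w) -> w < l ->
  club_in k D -> club_in k (high_limits D).
Proof.
move=> w_inf wl Dclub.
suff -> : high_limits D = below k `&` \bigcap_(nu in below l)
    [set x | x < k /\ lim_of (D `&` [set y | nu < cf y]) x].
  apply: club_bigcap => [|nu nul]; first exact: card_lexx.
  apply: club_lim => b bk.
  have [||||c Dc [bc ck nuc]] := @unbounded_cf_gt D (Order.max nu w) b.
  - exact: Dclub.
  - by apply: infinite_below_le w_inf; rewrite le_max lexx orbT.
  - by rewrite gt_max nul wl.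
  - by [].
  exists c; last by rewrite bc ck.
  by split=> //; apply: le_lt_trans nuc; rewrite le_max lexx.
apply/seteqP; split=> x [xk xh]; split=> // nu nul; first by split=> //; exact: xh.
by have [] := xh _ nul.
Qed.

(** The witness is the least ordinal with more than [nu] predecessors, that is, the cardinal
    successor of [nu]. *)
Lemma exists_cf_gt nu : infinite_set (below nu) -> nu < l ->
  exists2 rho, rho <= l & nu < cf rho.
Proof.
move=> nu_inf nul.
have [|x xbig xmin] := @least_exists _ _ T_wo [set x | ~ (below x #<= below nu)].
  by exists l; have [] := l_card nul.
exists x; first by apply: xmin; have [] := l_card nul.
have [||] // := @cf_gt_of_card _ _ T_wo setT nu x nu_inf; last by rewrite setTI.
move=> y yx; rewrite setTI; apply: contrapT => /xmin; by rewrite leNgt yx.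
Qed.

End SuccessorCardinal.

(** * A thin C-sequence from weak square *)

Section ThinCSequence.
Context {d : Order.disp_t} {T : orderType d}.
Hypothesis T_wo : wochoice.well_order (<=%O : rel T).
Implicit Types (a b c l k x y z nu : T) (A B C D S : set T).

(** A cofinal set [A] of type [cf a] need not be closed. Replacing each [z] in [A] by the least
    strict upper bound of the elements of [A] below [z] adds the limits, and being monotone it does
    not increase the type. *)
Lemma limit_club_cf a : lim_of setT a -> exists2 e,
  [/\ e `<=` below a, forall y, y < a -> lim_of e y -> e y &
      forall b, b < a -> exists2 c, e c & b < c] &
  embeds e (cf a).
Proof.
move=> [_ aL].
have [A [Aa Acof] Acf] := embeds_cf_cofinal T_wo a.
pose ub z := [set y | forall x, A x -> x < z -> x < y].
have /choice[g gP] : forall z, exists y, least (ub z) y.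
  move=> z; apply: least_ex => //; exists z => x _; exact.
have gle z : g z <= z by have [_] := gP z; apply => x _.
exists (g @` A); last first.
  apply: embeds_image Acf => x y _ _ xy; have [_] := gP x; apply => z Az zx.
  by have [gy _] := gP y; apply: gy => //; exact: lt_le_trans xy.
split.
- by move=> _ [x /Aa xa <-]; exact: le_lt_trans xa.
- move=> y ya [y0 ey]; have [a0 Aa0 ya0] := Acof _ ya.
  have [|z [Az yz] zmin] := @least_exists _ _ T_wo [set z | A z /\ y <= z].
    by exists a0.
  have Alt x : A x -> x < z -> x < y.
    move=> Ax xz; rewrite ltNge; apply/negP => yx.
    by have := zmin x (conj Ax yx); rewrite leNgt xz.
  exists z => //; apply/eqP; rewrite eq_le; apply/andP; split.
    by have [_] := gP z; apply.
  rewrite leNgt; apply/negP => gzy.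
  have [_ [x Ax <-] [gzx gxy]] := ey _ gzy.
  have xz : x < z.
    rewrite ltNge; apply/negP; rewrite le_eqVlt => /predU1P[E|zx].
      by move: gzx; rewrite E ltxx.
    have [gx _] := gP x; have := gx _ Az zx.
    by move=> /(le_lt_trans yz) /(lt_trans gxy); rewrite ltxx.
  have gxgz : g x <= g z.
    have [_] := gP x; apply => w Aw wx.
    by have [gz _] := gP z; apply: gz => //; exact: lt_trans xz.
  by have := lt_le_trans gzx gxgz; rewrite ltxx.
- move=> b ba; have [x Ax bx] := Acof _ ba.
  have [b' _ [xb' b'a]] := aL _ (Aa _ Ax).
  have [y Ay b'y] := Acof _ b'a; exists (g y); first by exists y.
  have [gy _] := gP y; apply: le_lt_trans bx _; apply: gy => //.
  exact: lt_le_trans b'y.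
Qed.

Context (l k : T) (l_sing : singular l) (kP : is_succ_cardinal l k).

Let l_inf : infinite_set (below l). Proof. by case: l_sing. Qed.

Lemma card_le_succ_below a : a < k -> [set b | b <= a] #<= below l.
Proof.
move=> ak; apply: (@card_le_trans _ _ _ (below a `|` [set a])).
  apply: subset_card_le => x /=.
  by rewrite le_eqVlt => /predU1P[->|xa]; [right|left].
apply: card_le_setU => //; last exact: card_le_set1.
exact: (card_below_succ_cardinal T_wo kP).
Qed.

(** The singleton of the predecessor at successors and empty at 0 and at limits: it serves as the
    C-set at every non-limit ordinal. *)
Definition max_below a : set T := [set x | x < a /\ forall y, y < a -> y <= x].

Lemma max_below_inj a x y : max_below a x -> max_below a y -> x = y.
Proof. by move=> [xa xm] [ya ym]; apply/eqP; rewrite eq_le xm // ym. Qed.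

Lemma lim_max_below a y : ~ lim_of (max_below a) y.
Proof.
move=> [[x xy] h]; have [c ca [xc cy]] := h _ xy.
have [c' ca' [cc' _]] := h _ cy.
by move: cc'; rewrite (max_below_inj ca ca') ltxx.
Qed.

Lemma cofinal_max_below a : ~ limit_ord a -> cofinal_in a (max_below a).
Proof.
move=> /limit_ordP aN; split=> [x []//|b ba].
have [|m ma mmax] := lim_ofN _ aN; first by exists b.
exists m; last exact: mmax.
by split=> // y ya; exact: mmax.
Qed.

Lemma embeds_max_below a : embeds (max_below a) (cf a).
Proof.
have [[x xa]|nx] := pselect (max_below a !=set0); last first.
  by exists id; split=> [x xa|x y /set_mem xa]; case: nx; exists x.
have [A [Aa Acof] [r [rcf _]]] := embeds_cf_cofinal T_wo a.
have [c Ac _] := Acof x xa.1.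
exists (fun=> r c); split=> [_ _|y z /set_mem ya /set_mem za]; first exact: rcf.
by rewrite (max_below_inj ya za) ltxx.
Qed.

(** One member of each family is chosen. The square controls traces only at accumulation points; the
    other traces are bounded by induction on [a]. *)
Lemma weak_square_C_sequence : weak_square l k -> exists C : T -> set T,
  [/\ forall a, a < k -> closed_in a (C a) /\ cofinal_in a (C a),
      forall a, a < k -> limit_ord a -> embeds (C a) l,
      forall a, ~ limit_ord a -> C a = max_below a &
      forall a, a < k -> [set C b `&` below a | b in below k] #<= below l].
Proof.
move=> [CC CCP].
have /choice[C CP] : forall a, exists C,
    (a < k -> limit_ord a -> CC a C) /\ (~ limit_ord a -> C = max_below a).
  move=> a; have [aL|aN] := pselect (limit_ord a); last by exists (max_below a).
  have [/CCP/(_ aL)[[C aC] _ _ _]|aN] := pselect (a < k); last by exists set0.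
  by exists C.
have CC_C a : a < k -> limit_ord a -> CC a (C a) by have [] := CP a.
have CE a : ~ limit_ord a -> C a = max_below a by have [] := CP a.
have Cclub a : a < k -> closed_in a (C a) /\ cofinal_in a (C a).
  move=> ak; have [aL|aN] := pselect (limit_ord a).
    have [_ _ /(_ _ (CC_C _ ak aL))[[aC Ccof] _] _] := CCP _ ak aL.
    by split.
  rewrite CE //; split; last exact: cofinal_max_below.
  by apply/closed_inE; split=> [x []//|y _ /lim_max_below].
exists C; split=> //.
  move=> a ak aL; have [_ _ /(_ _ (CC_C _ ak aL))[_ Cotp] _] := CCP _ ak aL.
  exact/(otp_leP T_wo l).
elim/(lt_ind T_wo) => a IH ak.
pose Fam b := [set C b' `&` below b | b' in below k].
pose CCa := [set X | limit_ord a /\ CC a X].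
(* A trace on [a] is empty, or belongs to [CC a] when [a] is a limit of [C b], or has [b <= a], or
   is a trace on some smaller ordinal with that ordinal possibly added. *)
apply: (@card_le_trans _ _ _ ([set set0] `|` (CCa `|`
  ([set C b `&` below a | b in [set b | b <= a]] `|`
   \bigcup_(b in below a) (Fam b `|` [set X `|` [set b] | X in Fam b])))));
  last first.
  apply: card_le_setU => //; first exact: card_le_set1.
  apply: card_le_setU => //.
    have [aL|aN] := pselect (limit_ord a); last first.
      by rewrite (_ : CCa = set0) ?card_ge0 // -subset0 => X [].
    have [_ CCl _ _] := CCP _ ak aL.
    by apply: card_le_trans CCl; apply: subset_card_le => X [].
  apply: card_le_setU => //.
    by apply: card_le_trans (card_image_le _ _) _; exact: card_le_succ_below.
  apply: card_le_bigcup => //; first exact: (card_below_succ_cardinal T_wo kP).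
  move=> b ba; have bl := IH _ ba (lt_trans ba ak).
  by apply: card_le_setU => //; apply: card_le_trans (card_image_le _ _) _.
apply: subset_card_le => _ [b bk <-]; have [Cb_closed Cb_cof] := Cclub _ bk.
have [ba|ab] := leP b a; first by right; right; left; exists b.
have [[a0 a0a]|a0] := pselect (below a !=set0); last first.
  by left; apply/seteqP; split=> // x [_ xa]; case: a0; exists x.
have [Clim|Cnlim] := pselect (lim_of (C b) a).
  right; left; have aL : limit_ord a by apply/limit_ordP; apply: lim_ofS Clim.
  split=> //.
  have bL : limit_ord b.
    by apply: contrapT => /CE bE; move: Clim; rewrite bE => /lim_max_below.
  have [_ _ _] := CCP _ bk bL; apply; first exact: CC_C.
  by apply/accE; split=> //; case/closed_inE: Cb_closed => _; apply.
right; right; right; have [|b' b'a Cb'] := lim_ofN _ Cnlim; first by exists a0.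
exists b' => //; have [Cbb'|nCbb'] := pselect (C b b').
  right; exists (C b `&` below b'); first by exists b.
  apply/seteqP; split=> [x [[Cx xb']|->]|x [Cx /(Cb' _ Cx)]] //.
    by split=> //; exact: lt_trans b'a.
  by rewrite le_eqVlt => /predU1P[->|xb']; [right|left].
left; exists b => //; apply/seteqP; split=> [x [Cx xb']|x [Cx /(Cb' _ Cx)]].
  by split=> //; exact: lt_trans b'a.
by rewrite le_eqVlt => /predU1P[E|xb'] //; case: nCbb'; rewrite -E.
Qed.

(* A club of type eps is replaced by its points whose position lies in a fixed
   club of eps of type cf eps; as eps ranges over the ordinals up to l, this
   multiplies the number of traces on a by at most l. *)
Lemma weak_square_thin : weak_square l k -> exists C : T -> set T,
  [/\ forall a, a < k -> closed_in a (C a) /\ cofinal_in a (C a),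
      forall a, a < k -> embeds (C a) (cf a) &
      forall a, a < k -> [set C b `&` below a | b in below k] #<= below l].
Proof.
move=> /weak_square_C_sequence[C0 [C0club C0l C0E C0coh]].
have /choice[e eP] : forall a, exists e, lim_of setT a ->
    [/\ e `<=` below a, forall y, y < a -> lim_of e y -> e y &
      forall b, b < a -> exists2 c, e c & b < c] /\ embeds e (cf a).
  move=> a; have [/limit_club_cf[e ? ?]|aN] := pselect (lim_of setT a); last by exists set0.
  by exists e.
pose r A x := otp l (A `&` below x).
(* [E] is a separate argument because the trace of [C0 b] on [a] does not determine the type of
   [C0 b]. *)
pose thin (A : set T) (E : T) := [set x | A x /\ e E (r A x)].
pose C a := if pselect (limit_ord a) then thin (C0 a) (otp l (C0 a)) else max_below a.
have Climit a : limit_ord a -> C a = thin (C0 a) (otp l (C0 a)).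
  by rewrite /C; case: pselect.
have Cnonlimit a : ~ limit_ord a -> C a = max_below a.
  by rewrite /C; case: pselect.
suff Climit_club a : a < k -> limit_ord a ->
    [/\ closed_in a (C a), cofinal_in a (C a) & embeds (C a) (cf a)].
  exists C; split=> [a ak|a ak|a ak].
  - have [aL|aN] := pselect (limit_ord a); first by have [] := Climit_club a ak aL; split.
    by rewrite Cnonlimit // -C0E //; exact: C0club.
  - have [aL|aN] := pselect (limit_ord a); first by have [] := Climit_club a ak aL.
    by rewrite Cnonlimit //; exact: embeds_max_below.
  pose Fam0 := [set C0 b `&` below a | b in below k].
  apply: (@card_le_trans _ _ _ (Fam0 `|` \bigcup_(X in Fam0)
      [set thin X E | E in [set E | E <= l]])); last first.
    apply: card_le_setU => //; first exact: C0coh.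
    apply: card_le_bigcup => //; first exact: C0coh.
    move=> X _; apply: card_le_trans (card_image_le _ _) _.
    by apply: card_le_succ_below; exact: lt_succ_cardinal.
  apply: subset_card_le => _ [b bk <-]; have [bL|bN] := pselect (limit_ord b).
    right; exists (C0 b `&` below a); first by exists b.
    exists (otp l (C0 b)); first by have [] := otp_embeds T_wo l (C0l _ bk bL).
    rewrite Climit // /thin /r; apply/seteqP.
    have rE x : x < a -> (C0 b `&` below a) `&` below x = C0 b `&` below x.
      move=> xa; apply/seteqP; split=> y [].
        by move=> [].
      by move=> Cy yx; split=> //; split=> //; exact: lt_trans xa.
    split=> x /= [[Cx h1] h2]; first by rewrite -(rE _ h1).
    by rewrite rE.
  by left; exists b => //; rewrite Cnonlimit // C0E.
move=> ak aL; rewrite Climit //; set E := otp l (C0 a).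
have [/closed_inE[C0a C0cl] [_ C0cof]] := C0club _ ak; have Cal := C0l _ ak aL.
have {}C0cof b : b < a -> exists2 c, C0 a c & b < c.
  move=> ba; have /limit_ordP[_ aL'] := aL; have [b' _ [bb' b'a]] := aL' _ ba.
  by have [c ? b'c] := C0cof _ b'a; exists c => //; exact: lt_le_trans b'c.
have r_homo x y : C0 a x -> x < y -> r (C0 a) x < r (C0 a) y.
  by move=> Cx; exact: (otp_seg_homo T_wo l Cal).
have r_lt x : C0 a x -> r (C0 a) x < E by move=> Cx; exact: (otp_seg_lt T_wo l Cal).
have r_surj j : j < E -> exists2 x, C0 a x & r (C0 a) x = j.
  by move=> jE; exact: (otp_seg_surj T_wo Cal).
have r_le x y : C0 a x -> C0 a y -> r (C0 a) x < r (C0 a) y -> x < y.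
  move=> Cx Cy; apply: contraTT; rewrite -!leNgt le_eqVlt => /predU1P[->//|yx].
  by apply: ltW; exact: r_homo.
have EL : lim_of setT E.
  have [[x0 x0a] _] := aL.
  split=> [|j jE].
    by have [c Cc _] := C0cof _ x0a; exists (r (C0 a) c); exact: r_lt.
  have [x Cx <-] := r_surj _ jE; have [y Cy xy] := C0cof _ (C0a _ Cx).
  by exists (r (C0 a) y) => //; split; [exact: r_homo|exact: r_lt].
have [[eE ecl ecof] ecf] := eP _ EL.
split.
- apply/closed_inE; split=> [x [/C0a]//|y ya ylim].
  have Cy : C0 a y by apply: C0cl => //; apply: lim_ofS ylim => x [].
  split=> //; apply: ecl; first exact: r_lt.
  have [[x xy] yC] := ylim; split.
    by have [c [Cc _] [_ cy]] := yC _ xy; exists (r (C0 a) c); exact: r_homo.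
  move=> j jy; have [x' Cx' jE] := r_surj _ (lt_trans jy (r_lt _ Cy)).
  have [|c [Cc ec] [x'c cy]] := yC x'; first by apply: r_le => //; rewrite jE.
  by exists (r (C0 a) c) => //; split; [rewrite -jE; exact: r_homo|exact: r_homo].
- split=> [x [/C0a]//|b ba]; have [z Cz bz] := C0cof _ ba.
  have [j ej rj] := ecof _ (r_lt _ Cz); have [x Cx jE] := r_surj _ (eE _ ej).
  exists x; first by split=> //; rewrite jE.
  by apply: ltW; apply: lt_trans bz _; apply: r_le => //; rewrite jE.
have [A [Aa Acof] /embeds_card Acf] := embeds_cf_cofinal T_wo a.
(* Pushing a cofinal subset of [a] up into [C0 a] and taking positions gives a cofinal subset of
   [E]. *)
have cfE : cf E <= cf a.
  have /choice[m mP] : forall x, exists c, x < a -> C0 a c /\ x < c.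
    move=> x; have [/C0cof[c ? ?]|nx] := pselect (x < a); first by exists c.
    by exists x.
  apply: (@cf_le_card _ _ T_wo _ ((r (C0 a) \o m) @` A)); last first.
    exact: card_le_trans (card_image_le _ _) Acf.
  split=> [_ [x /Aa/mP[Cm _] <-]|j jE]; first exact: r_lt.
  have [x Cx <-] := r_surj _ jE; have [y Ay xy] := Acof _ (C0a _ Cx).
  have [Cm ym] := mP _ (Aa _ Ay).
  exists (r (C0 a) (m y)); first by exists y.
  by apply: ltW; apply: r_homo => //; exact: le_lt_trans ym.
have [s [scf slt]] := embeds_le cfE ecf.
exists (s \o r (C0 a)); split=> [x [_ /scf]//|x y /set_mem[Cx ex] /set_mem[Cy ey] xy].
by apply: slt; [exact: mem_set|exact: mem_set|exact: r_homo].
Qed.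

End ThinCSequence.

(** * Walks along the C-sequence guided by a club *)

Section Walks.
Context {d : Order.disp_t} {T : orderType d}.
Hypothesis T_wo : wochoice.well_order (<=%O : rel T).
Implicit Types (a b c l k x y z nu th : T) (A B D S : set T).

Definition from x : set T := [set y | x <= y].

Lemma least_inj A x y : least A x -> least A y -> x = y.
Proof. by move=> [Ax xA] [Ay yA]; apply/eqP; rewrite eq_le xA // yA. Qed.

Definition max_le D b c : Prop :=
  [/\ D c, c <= b & forall y, D y -> y <= b -> y <= c].

Lemma max_le_inj D b x y : max_le D b x -> max_le D b y -> x = y.
Proof.
by move=> [Dx xb xm] [Dy yb ym]; apply/eqP; rewrite eq_le ym // xm.
Qed.

Context (C : T -> set T).

(* One step of the walk from a down to x, where eta is the next point of C a;
   eta is moved down to the club D. *)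
Definition step D a x c : Prop :=
  D x /\ exists2 eta, least (C a `&` from x) eta & max_le D eta c.

(** The cofinality is tested at the ordinals left behind, never at the endpoint, so [x] may have any
    cofinality. *)
Inductive walk D th : T -> T -> Prop :=
| walk_refl a : walk D th a a
| walk_step a c x : cf a <= th -> step D a x c -> walk D th c x -> walk D th a x.

(* The threshold is read off the part of C a below the target, so that it does
   not spoil weak coherence. *)
Definition walk_set D (t : set T -> T) a : set T :=
  [set x | exists2 c, step D a x c & walk D (t (C a `&` below x)) c x].

Lemma walk_stepE D th a x : walk D th a x -> x <> a ->
  cf a <= th /\ walk_set D (fun=> th) a x.
Proof.
by case=> [b /(_ erefl)[]|b c y cfb bc cy _]; split=> //; exists c.
Qed.

Lemma walk_mono D th th' a x : th <= th' -> walk D th a x -> walk D th' a x.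
Proof.
move=> thth'; elim=> [b|b c y cfb bc _ cy]; first exact: walk_refl.
by apply: walk_step cy => //; exact: le_trans cfb _.
Qed.

(** With no point of [C a] in [x, y), walks to [x] and to [y] take the same first step; by the
    companion fact below they also read the same threshold. *)
Lemma gap_from a x y : x <= y -> (forall c, C a c -> c < y -> c < x) ->
  C a `&` from x = C a `&` from y.
Proof.
move=> xy gap; apply/seteqP; split=> c [Cc xc]; split=> //.
  by rewrite /from /= leNgt; apply/negP => /(gap _ Cc); rewrite ltNge xc.
exact: le_trans xc.
Qed.

Lemma gap_below a x y : x <= y -> (forall c, C a c -> c < y -> c < x) ->
  C a `&` below x = C a `&` below y.
Proof.
move=> xy gap; apply/seteqP; split=> c [Cc xc]; split=> //.
  exact: lt_le_trans xy.
exact: gap.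
Qed.

Context (l k : T) (l_card : is_cardinal l) (l_inf : infinite_set (below l)).
Hypothesis kP : is_succ_cardinal l k.
Hypothesis C_club : forall a, a < k -> closed_in a (C a) /\ cofinal_in a (C a).
Hypothesis C_cf : forall a, a < k -> embeds (C a) (cf a).
Hypothesis C_coherent : forall a, a < k ->
  [set C b `&` below a | b in below k] #<= below l.

Lemma C_below a x : a < k -> C a x -> x < a.
Proof. by move=> /C_club[[Ca _] _]; exact: Ca. Qed.

Lemma C_next a x : a < k -> x < a -> exists2 eta, least (C a `&` from x) eta & eta < a.
Proof.
move=> ak xa; have [_ [_ /(_ _ xa)[c Cc xc]]] := C_club ak.
have [|eta [[Ceta xeta] etamin]] := least_ex T_wo (P := C a `&` from x).
  by exists c.
by exists eta; [split|exact: C_below Ceta].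
Qed.

Lemma step_lt D a x c : a < k -> step D a x c -> x <= c /\ c < a.
Proof.
move=> ak [Dx [eta [[Ceta xeta] _] [Dc ceta cmax]]]; split; first exact: cmax.
exact: le_lt_trans (C_below ak Ceta).
Qed.

Lemma walk_set_below D t a : a < k -> walk_set D t a `<=` below a.
Proof.
move=> ak x [c /(step_lt ak)[xc ca] _]; exact: le_lt_trans ca.
Qed.

Lemma max_le_exists D b x : club_in k D -> b < k -> D x -> x <= b ->
  exists c, max_le D b c.
Proof.
move=> /(club_inE T_wo l_inf kP)[_ Dcl _] bk Dx xb.
have [|z zub zmin] :=
    @least_exists _ _ T_wo [set z | forall y, D y -> y <= b -> y <= z].
  by exists b.
have zb : z <= b by exact: zmin.
have [Dz|nDz] := pselect (D z); first by exists z; split.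
exfalso; apply: (nDz); apply: Dcl; first exact: le_lt_trans bk.
have zD e : e < z -> exists2 c, D c & e < c /\ c < z.
  move=> ez; apply: contrapT => nc; suff : z <= e by rewrite leNgt ez.
  apply: zmin => y Dy yb; rewrite leNgt; apply/negP => ey; apply: nc.
  exists y => //; split=> //; rewrite lt_neqAle zub // andbT.
  by apply/eqP => yz; apply: nDz; rewrite -yz.
split=> //; exists x; rewrite /below /= lt_neqAle zub // andbT; apply/eqP => xz.
by apply: nDz; rewrite -xz.
Qed.

(** If [y] is a limit of [C a], the first step towards [y] lands on [y]. Otherwise all targets close
    enough below [y] share the first step [c] of [y], and [y] is a limit of the walks from [c]. *)
Lemma walk_set_lim D t a y : club_in k D -> a < k -> y < a ->
  (forall c, c < a -> y <= c -> lim_of (walk D (t (C a `&` below y)) c) y ->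
     walk D (t (C a `&` below y)) c y) ->
  lim_of (walk_set D t a) y -> walk_set D t a y.
Proof.
move=> Dclub ak ya IH ylim; have yk := lt_trans ya ak.
have Dy : D y.
  have /(club_inE T_wo l_inf kP)[_ Dcl _] := Dclub.
  by apply: Dcl => //; apply: lim_ofS ylim => x [c []].
have [eta [[Ceta yeta] etamin] eta_a] := C_next ak ya.
have [c cmax] := max_le_exists Dclub (lt_trans eta_a ak) Dy yeta.
have [_ ceta cmax'] := cmax; have yc : y <= c by exact: cmax'.
exists c; first by split=> //; exists eta.
have [Clim|Cnlim] := pselect (lim_of (C a) y).
  have [/closed_inE[_ Ccl] _] := C_club ak.
  have -> : c = y; last exact: walk_refl.
  apply/eqP; rewrite eq_le yc andbT; apply: le_trans ceta _; apply: etamin.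
  by split; [exact: Ccl|exact: lexx].
have [y0 yV] := ylim; have [b b_y Cb] := lim_ofN y0 Cnlim.
have ca : c < a by exact: le_lt_trans eta_a.
apply: IH => //; split=> // e ey.
have [|x [c' [_ [eta' eta'min c'max]] c'x] [bex xy]] := yV (Order.max b e).
  by rewrite gt_max b_y.
move: bex; rewrite gt_max => /andP[bx ex]; exists x => //.
have gap z : C a z -> z < y -> z < x by move=> Cz zy; exact: le_lt_trans (Cb _ Cz zy) bx.
move: eta'min c'x; rewrite (gap_from (ltW xy) gap) (gap_below (ltW xy) gap).
move=> eta'min; have eta'E : eta' = eta by apply: least_inj eta'min _; split.
by move: c'max; rewrite eta'E => /(max_le_inj cmax) ->.
Qed.

Lemma walk_lim D th a y : club_in k D -> a < k -> y <= a ->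
  lim_of (walk D th a) y -> walk D th a y.
Proof.
move=> Dclub; elim/(lt_ind T_wo): a y => a IH y ak.
rewrite le_eqVlt => /predU1P[-> _|ya ylim]; first exact: walk_refl.
have wlim : lim_of (walk_set D (fun=> th) a) y.
  have [y0 yW] := ylim; split=> // b /yW[x ax [bx xy]]; exists x => //.
  by have [|_] := walk_stepE ax; first by apply/eqP; rewrite lt_eqF ?(lt_trans xy).
have cfa : cf a <= th.
  have [[b b_y] yW] := ylim; have [x ax [_ xy]] := yW _ b_y.
  by have [|cfa _] := walk_stepE ax; first by apply/eqP; rewrite lt_eqF ?(lt_trans xy).
have [|c ac cy] := walk_set_lim Dclub ak ya _ wlim; last exact: walk_step cy.
by move=> c ca yc; apply: IH => //; exact: lt_trans ak.
Qed.

Lemma walk_set_closed D t a : club_in k D -> a < k -> closed_in a (walk_set D t a).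
Proof.
move=> Dclub ak; apply/closed_inE; split; first exact: walk_set_below.
move=> y ya ylim; apply: walk_set_lim => // c ca yc.
by apply: walk_lim => //; exact: lt_trans ak.
Qed.

(** * Cardinality of the sets of endpoints of walks *)

Section CardinalBound.
Context (nu : T) (nu_inf : infinite_set (below nu)).

Lemma card_max_le_walk D th b :
  (forall c, c <= b -> walk D th c #<= below nu) ->
  [set x | exists2 c, max_le D b c & walk D th c x] #<= below nu.
Proof.
move=> small; have [[c cmax]|nc] := pselect (exists c, max_le D b c).
  apply: card_le_trans (small c _); last by case: cmax.
  by apply: subset_card_le => x [c' /(max_le_inj cmax) <-].
rewrite (_ : [set x | _] = set0) ?card_ge0 // -subset0 => x [c cmax _].
by apply: nc; exists c.
Qed.

(** A nontrivial walk leaves [a] through one of at most [th] points of [C a], each of which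
    determines the next ordinal; induction bounds the rest. *)
Lemma card_walk D th a : th <= nu -> a < k -> walk D th a #<= below nu.
Proof.
move=> th_nu; elim/(lt_ind T_wo): a => a IH ak.
have [cfa|cfa] := leP (cf a) th; last first.
  apply: card_le_trans (card_le_set1 nu_inf a); apply: subset_card_le => x ax.
  apply: contrapT => /(walk_stepE ax)[]; by rewrite leNgt cfa.
apply: (@card_le_trans _ _ _ ([set a] `|` \bigcup_(eta in C a)
    [set x | exists2 c, max_le D eta c & walk D th c x])).
  apply: subset_card_le => x ax; have [->|xa] := eqVneq x a; first by left.
  have [|_ [c [_ [eta [[Ceta _] _] cmax]] cx]] := walk_stepE ax; first exact/eqP.
  by right; exists eta => //; exists c.
apply: card_le_setU => //; first exact: card_le_set1.
apply: card_le_bigcup => //.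
  exact: embeds_card (embeds_le (le_trans cfa th_nu) (C_cf ak)).
move=> eta /(C_below ak) eta_a; apply: card_max_le_walk => c c_eta.
by apply: IH; [exact: le_lt_trans eta_a|exact: le_lt_trans (lt_trans eta_a ak)].
Qed.

(** Below [z] all thresholds are at most [nu], so the walks are walks with constant threshold [nu];
    [cf a <= nu] is assumed because the first step is not tested. *)
Lemma card_walk_set D t a z : a < k -> cf a <= nu ->
  (forall x, x < z -> t (C a `&` below x) <= nu) ->
  walk_set D t a `&` below z #<= below nu.
Proof.
move=> ak cfa t_nu.
apply: (@card_le_trans _ _ _ (\bigcup_(eta in C a)
    [set x | exists2 c, max_le D eta c & walk D nu c x])).
  apply: subset_card_le => x [[c [_ [eta [[Ceta _] _] cmax]] cx] xz].
  by exists eta => //; exists c => //; exact: walk_mono (t_nu _ xz) _.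
apply: card_le_bigcup => //; first exact: embeds_card (embeds_le cfa (C_cf ak)).
move=> eta /(C_below ak) eta_a; apply: card_max_le_walk => c c_eta.
by apply: card_walk => //; exact: le_lt_trans (lt_trans eta_a ak).
Qed.

End CardinalBound.

(* [walk_set D t a] below y is computed from g, the part of C a below y, and from
   Y, the part of the walk that steps to y or beyond. *)
Definition walk_trace D (t : set T -> T) y (g Y : set T) : set T :=
  [set x | x < y /\ D x /\
    ((exists2 c, exists2 eta, least (g `&` from x) eta & max_le D eta c &
        walk D (t (g `&` below x)) c x) \/
     (g `&` from x = set0 /\ Y x))].

(** Targets are split by whether the next point of [C a] lies below [y]. If not, they share the
    first step of [y] and its threshold, so a single walk from some [c < a] accounts for them. *)
Lemma walk_set_trace D t a y : a < k -> exists Y,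
  walk_set D t a `&` below y = walk_trace D t y (C a `&` below y) Y /\
  (Y = set0 \/ exists2 c, c < a & Y = walk D (t (C a `&` below y)) c `&` below y).
Proof.
move=> ak; exists [set x | exists2 c,
  exists2 eta, least (C a `&` from y) eta & max_le D eta c &
  (walk D (t (C a `&` below y)) c `&` below y) x]; split; last first.
  have [[c [eta etamin cmax]]|nc] := pselect (exists c,
      exists2 eta, least (C a `&` from y) eta & max_le D eta c).
    right; exists c.
      have [[Ceta _] _] := etamin; have [_ ceta _] := cmax.
      exact: le_lt_trans (C_below ak Ceta).
    apply/seteqP; split=> x.
      move=> [c' [eta' /(least_inj etamin) <-] /(max_le_inj cmax) <-] //.
    by move=> cx; exists c => //; exists eta.
  by left; rewrite -subset0 => x [c cP _]; apply: nc; exists c.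
have belowE x : x < y -> (C a `&` below y) `&` below x = C a `&` below x.
  move=> xy; apply/seteqP; split=> z; first by move=> [[]].
  by move=> [Cz zx]; split=> //; split=> //; exact: lt_trans xy.
apply/seteqP; split=> x.
  move=> [[c [Dx [eta [[Ceta xeta] etamin] cmax]] cx] xy]; split=> //; split=> //.
  have [eta_y|y_eta] := ltP eta y.
    left; exists c; last by rewrite belowE.
    by exists eta => //; split=> // z [[Cz _] xz]; exact: etamin.
  have gap z : C a z -> z < y -> z < x.
    move=> Cz zy; rewrite ltNge; apply/negP => xz.
    by have := etamin z (conj Cz xz); rewrite leNgt (lt_le_trans zy).
  right; split.
    by rewrite -subset0 => z [[Cz zy]]; rewrite /from /= leNgt gap.
  exists c; last by split=> //; rewrite -(gap_below (ltW xy) gap).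
  by exists eta => //; rewrite -(gap_from (ltW xy) gap); split.
move=> [xy [Dx [[c [eta [[[Ceta eta_y] xeta] etamin] cmax] cx]|[gE]]]].
  split=> //; exists c; last by rewrite -(belowE _ xy).
  split=> //; exists eta => //; split=> // z [Cz xz].
  have [zy|] := ltP z y; first by apply: etamin.
  by apply: le_trans; exact: ltW.
have gap z : C a z -> z < y -> z < x.
  move=> Cz zy; rewrite ltNge; apply/negP => xz.
  suff : set0 z by []; by rewrite -gE.
move=> [c [eta etamin cmax] [cx _]]; split=> //.
exists c; last by rewrite (gap_below (ltW xy) gap).
by split=> //; exists eta => //; rewrite (gap_from (ltW xy) gap).
Qed.

(** Starting from the walks from ordinals below [y], the family is closed under [walk_trace] for the
    at most [l] sets [g]. Walks are finite, so countably many rounds suffice. *)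
Lemma walk_coherent D th y : y < k -> exists2 F : set (set T), F #<= below l &
  F set0 /\ forall a, a < k -> F (walk D th a `&` below y).
Proof.
move=> yk; pose G := [set C b `&` below y | b in below k].
pose base := set0 |` [set walk D th b `&` below y | b in below y].
pose Fn := fix Fn n := if n is m.+1
  then \bigcup_(g in G) [set walk_trace D (fun=> th) y g Y | Y in Fn m] else base.
exists (\bigcup_n Fn n).
  apply: card_le_bigcup => //; first exact: card_le_nat.
  move=> n _; elim: n => [|n IH] /=.
    apply: card_le_setU => //; first exact: card_le_set1.
    apply: card_le_trans (card_image_le _ _) _.
    exact: (card_below_succ_cardinal T_wo kP).
  apply: card_le_bigcup => //; first exact: C_coherent.
  by move=> g _; exact: card_le_trans (card_image_le _ _) IH.
have F0 : (\bigcup_n Fn n) set0 by exists 0%N => //; left.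
split=> //; elim/(lt_ind T_wo) => a IH ak.
have [ay|ya] := ltP a y; first by exists 0%N => //; right; exists a.
have walkE : forall x, (walk D th a `&` below y) x -> cf a <= th /\ walk_set D (fun=> th) a x.
  move=> x [ax xy]; apply: walk_stepE => //; apply/eqP.
  by rewrite lt_eqF // (lt_le_trans xy).
have [cfa|cfa] := leP (cf a) th; last first.
  rewrite (_ : _ `&` _ = set0) // -subset0 => x /walkE[].
  by rewrite leNgt cfa.
have -> : walk D th a `&` below y = walk_set D (fun=> th) a `&` below y.
  apply/seteqP; split=> x; first by move=> ax; split; [have [] := walkE _ ax|case: ax].
  by move=> [[c ac cx] xy]; split=> //; exact: walk_step cx.
have [Y [-> YP]] := walk_set_trace D (fun=> th) y ak.
have [n _ FnY] : (\bigcup_n Fn n) Y.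
  by case: YP => [->//|[c ca ->]]; apply: IH => //; exact: lt_trans ak.
exists n.+1 => //=; exists (C a `&` below y); first by exists a.
by exists Y.
Qed.

(** The part [Y] of the trace uses the single threshold [t g], so it lies in the family of traces
    obtained for that constant threshold. *)
Lemma walk_set_coherent D t y : y < k ->
  [set walk_set D t b `&` below y | b in below k] #<= below l.
Proof.
move=> yk.
have /choice[F FP] : forall th, exists F : set (set T), [/\ F #<= below l, F set0 &
    forall a, a < k -> F (walk D th a `&` below y)].
  by move=> th; have [F ? []] := walk_coherent D th yk; exists F.
apply: (@card_le_trans _ _ _ (\bigcup_(g in [set C b `&` below y | b in below k])
    [set walk_trace D t y g Y | Y in F (t g)])).
  apply: subset_card_le => _ [b bk <-].
  have [Y [-> YP]] := walk_set_trace D t y bk.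
  exists (C b `&` below y); first by exists b.
  exists Y => //; have [_ F0 FW] := FP (t (C b `&` below y)).
  by case: YP => [->//|[c cb ->]]; apply: FW; exact: lt_trans bk.
apply: card_le_bigcup => //; first exact: C_coherent.
move=> g _; apply: card_le_trans (card_image_le _ _) _; by have [] := FP (t g).
Qed.

End Walks.

(** * Club guessing by walks *)

Section Guessing.
Context {d : Order.disp_t} {T : orderType d}.
Hypothesis T_wo : wochoice.well_order (<=%O : rel T).
Implicit Types (a b c l k x y z nu th xi i h : T) (A B D S : set T).

Context (l k : T) (l_sing : singular l) (kP : is_succ_cardinal l k).

Let l_card : is_cardinal l. Proof. by case: l_sing. Qed.
Let l_inf : infinite_set (below l). Proof. by case: l_sing. Qed.

Context (C : T -> set T).
Hypothesis C_club : forall a, a < k -> closed_in a (C a) /\ cofinal_in a (C a).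
Hypothesis C_cf : forall a, a < k -> embeds (C a) (cf a).
Hypothesis C_coherent : forall a, a < k ->
  [set C b `&` below a | b in below k] #<= below l.

Lemma cf_lt_singular a : a < k -> cf a < l.
Proof.
move=> ak; have [_ _ cfl] := l_sing.
exact: (cf_below_singular T_wo cfl (card_below_succ_cardinal T_wo kP ak)).
Qed.

(** Falling back on [C a] when the walk set is not cofinal or is too long makes this a transversal
    for every club [D] and every [t]. *)
Definition walk_sequence D t a : set T :=
  if pselect (cofinal_in a (walk_set C D t a) /\ embeds (walk_set C D t a) l)
  then walk_set C D t a else C a.

Lemma walk_sequence_transversal D t :
  club_in k D -> weak_square_transversal l k (walk_sequence D t).
Proof.
move=> Dclub; split.
- move=> a ak; have [Cclosed Ccof] := C_club ak; rewrite /walk_sequence.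
  case: pselect => [[Vcof ?]|?].
    split; first exact: (walk_set_closed T_wo l_inf kP C_club).
    exact: supremums_cofinal.
  by split=> //; exact: supremums_cofinal.
- move=> a ak; have small : [set walk_sequence D t b `&` below a | b in below k] #<= below l.
    apply: card_le_trans (card_le_setU T_wo l_inf
      (walk_set_coherent T_wo l_inf kP C_club C_coherent D t ak) (C_coherent ak)).
    apply: subset_card_le => _ [b bk <-]; rewrite /walk_sequence.
    by case: pselect => ?; [left|right]; exists b.
  split.
    apply: card_le_trans small _; apply: subset_card_le => x /lt_trans; apply.
    exact: lt_succ_cardinal.
  move=> /card_le_trans/(_ small).
  by have [[k_card lk] _] := kP; have [] := k_card _ lk.
- move=> a ak; apply/(otp_leP T_wo l); rewrite /walk_sequence.
  case: pselect => [[]//|?]; apply: embeds_le (C_cf ak).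
  exact/ltW/cf_lt_singular.
Qed.

(** * Walks along a decreasing sequence of clubs *)

Section Stabilization.
Context (rho : T) (Dseq : T -> set T).
Hypothesis rho0 : below rho !=set0.
Hypothesis Dseq_club : forall xi, xi < rho -> club_in k (Dseq xi).
Hypothesis Dseq_le : forall xi xi', xi <= xi' -> Dseq xi' `<=` Dseq xi.

Let Dall x := forall xi, xi < rho -> Dseq xi x.

(** As the clubs shrink, their greatest element below [eta] can only decrease, so it is constant
    from the stage where its least value is attained. *)
Lemma max_le_stable eta tau : eta < k -> Dall tau -> tau <= eta ->
  exists c, [/\ tau <= c, c <= eta, Dall c &
    exists2 xi0, xi0 < rho & forall xi, xi0 <= xi -> xi < rho -> max_le (Dseq xi) eta c].
Proof.
move=> eta_k Dtau tau_eta.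
have maxD xi : xi < rho -> exists c, max_le (Dseq xi) eta c.
  move=> xir.
  exact: (max_le_exists T_wo l_inf kP (Dseq_club xir) eta_k (Dtau _ xir) tau_eta).
have [|c [xi0 xi0r c0] cmin] := @least_exists _ _ T_wo
    [set c | exists2 xi, xi < rho & max_le (Dseq xi) eta c].
  have [xi xir] := rho0; have [c cm] := maxD _ xir; by exists c, xi.
have [Dc c_eta cmax] := c0.
have stable xi : xi0 <= xi -> xi < rho -> max_le (Dseq xi) eta c.
  move=> xi0xi xir; have [c' c'm] := maxD _ xir; have [Dc' c'_eta _] := c'm.
  suff -> : c = c' by [].
  apply/eqP; rewrite eq_le; apply/andP; split; first by apply: cmin; exists xi.
  by apply: cmax => //; exact: Dseq_le Dc'.
exists c; split=> //; last by exists xi0.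
  by apply: cmax => //; exact: Dtau.
move=> xi xir; have [xi0xi|/ltW xixi0] := leP xi0 xi; first by have [] := stable _ xi0xi xir.
exact: Dseq_le Dc.
Qed.

(* The walk towards tau is stopped at the first ordinal of cofinality at least
   i; the finitely many ordinals passed before have cofinality at most some
   h < i. *)
Lemma walk_stable tau i b : Dall tau -> i <= cf tau -> below i !=set0 ->
  b < k -> tau <= b -> Dall b ->
  exists x, [/\ tau <= x, x <= b, i <= cf x, Dall x &
    exists2 h, h < i & exists2 xi0, xi0 < rho &
      forall xi, xi0 <= xi -> xi < rho -> walk C (Dseq xi) h b x].
Proof.
move=> Dtau itau [i0 i0i]; elim/(lt_ind T_wo): b => b IH bk taub Db.
have [ib|cfb] := leP i (cf b).
  exists b; split=> //; exists i0 => //; have [xi xir] := rho0.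
  by exists xi => // *; exact: walk_refl.
have tau_b : tau < b.
  by rewrite lt_neqAle taub andbT; apply/eqP => E; move: cfb; rewrite -E ltNge itau.
have [eta eta_least eta_b] := C_next T_wo C_club bk tau_b.
have [[Ceta taueta] etamin] := eta_least.
have [c [tauc c_eta Dc [xi1 xi1r c_max]]] := max_le_stable (lt_trans eta_b bk) Dtau taueta.
have cb : c < b by exact: le_lt_trans eta_b.
have [x [taux xc icf Dx [h hi [xi0 xi0r xw]]]] := IH _ cb (lt_trans cb bk) tauc Dc.
exists x; split=> //; first exact: le_trans (ltW cb).
exists (Order.max h (cf b)); first by rewrite gt_max hi.
exists (Order.max xi0 xi1); first by rewrite gt_max xi0r.
move=> xi; rewrite ge_max => /andP[xi0xi xi1xi] xir.
apply: walk_step (walk_mono _ (xw _ xi0xi xir)).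
- by rewrite le_max lexx orbT.
- split; first exact: Dx.
  exists eta; last exact: c_max.
  split=> [|z [Cz xz]]; first by split=> //; exact: le_trans c_eta.
  by apply: etamin; split=> //; exact: le_trans xz.
- by rewrite le_max lexx.
Qed.

(** The first step from [a] is free of the threshold, so [h] need not bound [cf a]. No point of
    [C a] lies in [tau, x), hence [t] takes the same value at [x] as at [tau]. *)
Lemma walk_set_stable tau i a : Dall tau -> i <= cf tau -> below i !=set0 ->
  a < k -> tau < a ->
  exists x, [/\ tau <= x, x < a, i <= cf x, Dall x &
    C a `&` below x = C a `&` below tau /\
    exists2 h, h < i & exists2 xi0, xi0 < rho &
      forall xi t, xi0 <= xi -> xi < rho -> h <= t (C a `&` below tau) ->
        walk_set C (Dseq xi) t a x].
Proof.
move=> Dtau itau i0 ak tau_a.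
have [eta [[Ceta taueta] etamin] eta_a] := C_next T_wo C_club ak tau_a.
have [c [tauc c_eta Dc [xi1 xi1r c_max]]] := max_le_stable (lt_trans eta_a ak) Dtau taueta.
have ca : c < a by exact: le_lt_trans eta_a.
have [x [taux xc icf Dx [h hi [xi0 xi0r xw]]]] :=
  walk_stable Dtau itau i0 (lt_trans ca ak) tauc Dc.
have gap z : C a z -> z < x -> z < tau.
  move=> Cz zx; rewrite ltNge; apply/negP => tauz; have := etamin z (conj Cz tauz).
  by rewrite leNgt (lt_le_trans zx) // (le_trans xc).
have CE := gap_below taux gap.
exists x; split=> //; first exact: le_lt_trans ca.
split; first by rewrite CE.
exists h => //; exists (Order.max xi0 xi1); first by rewrite gt_max xi0r.
move=> xi t; rewrite ge_max => /andP[xi0xi xi1xi] xir ht.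
exists c; last by rewrite -CE; exact: walk_mono ht (xw _ xi0xi xir).
split; first exact: Dx.
exists eta; last exact: c_max.
split=> [|z [Cz xz]]; first by split=> //; exact: le_trans c_eta.
by apply: etamin; split=> //; exact: le_trans xz.
Qed.

Context (w : T) (w_inf : infinite_set (below w)) (w_cf : w < cf l).
Context (delta : T) (delta_k : delta < k).

Let cf_l : cf l < l. Proof. by case: l_sing. Qed.

Lemma lt_limit i : i < l -> exists2 j, j < l & i < j.
Proof.
move=> il; have [||j jl ij] := @bounded_of_card _ _ T_wo l [set i] w _ _ w_cf.
- by move=> _ ->.
- exact: card_le_set1.
by exists j => //; exact: ij.
Qed.

(** The bound [m] limits the thresholds used below [x]; having it below [cf x] is what will keep [x]
    from being an accumulation point. *)
Definition reaches (t : set T -> T) b i : Prop := exists x m,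
  [/\ [/\ b <= x, x < delta, i <= cf x & Dall x],
      m < cf x, forall y, y < x -> t (C delta `&` below y) <= m &
      exists2 xi0, xi0 < rho & forall xi, xi0 <= xi -> xi < rho ->
        walk_set C (Dseq xi) t delta x].

Definition high_below nu b x : Prop := b < x /\ x < delta /\ nu < cf x.

(** One stage [xi] serves all pairs (b, i) because [cf rho] is large; cardinality of the walk set
    below its points gives both the order type bound and non-accumulation. *)
Lemma walk_sequence_guesses t (E : T -> set T) : cf delta < cf rho -> cf l < cf rho ->
  w < cf rho -> limit_ord delta ->
  (forall x, x < delta -> exists2 m, m < l &
    forall y, y < x -> t (C delta `&` below y) <= m) ->
  (forall b i, b < delta -> i < l -> reaches t b i) ->
  (forall xi xi', xi < xi' -> xi' < rho -> Dseq xi' `<=` E xi) ->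
  exists2 xi, xi < rho & forall i, i < l ->
    supremums (nacc (walk_sequence (Dseq xi) t delta) `&` E xi `&` E_ge k i) delta.
Proof.
move=> d_rho l_rho w_rho deltaL t_small t_reaches DE.
have [_ [Cd Ccof]] := C_club delta_k.
have [L [Ll Lcof] /embeds_card Lcf] := embeds_cf_cofinal T_wo l.
pose nu := Order.max (cf delta) (Order.max (cf l) w).
have nu_inf : infinite_set (below nu).
  by apply: infinite_below_le w_inf; rewrite !le_max lexx !orbT.
have nu_rho : nu < cf rho by rewrite !gt_max d_rho l_rho.
have nu_l : nu < l.
  by rewrite !gt_max cf_lt_singular // cf_l (lt_trans w_cf).
have nu_card a A : a <= nu -> A #<= below a -> A #<= below nu.
  move=> a_nu /card_le_trans; apply; apply: subset_card_le => x /lt_le_trans; exact.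
have /choice[s sP] : forall p : T * T, exists xi0, p.1 < delta -> p.2 < l ->
    xi0 < rho /\ exists x m, [/\ [/\ p.1 <= x, x < delta, p.2 <= cf x & Dall x],
      m < cf x, forall y, y < x -> t (C delta `&` below y) <= m &
      forall xi, xi0 <= xi -> xi < rho -> walk_set C (Dseq xi) t delta x].
  move=> [b i] /=; have [bd|nbd] := pselect (b < delta); last by exists b.
  have [il|nil] := pselect (i < l); last by exists b.
  have [x [m [xP m_x tm [xi0 xi0r xw]]]] := t_reaches b i bd il.
  by exists xi0 => _ _; split=> //; exists x, m.
(* It is enough to treat [b] in [C delta] and [i] in a cofinal subset of [l]: at most [nu] pairs,
   whose stages are bounded below [rho]. *)
have [||xi xir xi_s] := @bounded_of_card _ _ T_wo rho
    (\bigcup_(b in C delta) [set s (b, i) | i in L]) nu _ _ nu_rho.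
- by move=> _ [b /Cd bd [i /Ll il <-]]; have [] := sP (b, i) bd il.
- apply: card_le_bigcup => //.
    by apply: nu_card (embeds_card (C_cf delta_k)); rewrite le_max lexx.
  move=> b _; apply: card_le_trans (card_image_le _ _) _.
  by apply: nu_card Lcf; rewrite !le_max lexx !orbT.
(* A later stage below [rho] is needed because [Dseq xi'], and not [Dseq xi], is contained in
   [E xi]. *)
have [||xi' xi'r xi_xi'] := @bounded_of_card _ _ T_wo rho [set xi] nu _ _ nu_rho.
- by move=> _ ->.
- exact: card_le_set1.
have {}xi_xi' : xi < xi' by exact: xi_xi'.
exists xi => //; set V := walk_set C (Dseq xi) t delta.
have Vlt : V `<=` below delta by exact: (walk_set_below C_club).
have VP b i : b < delta -> i < l -> exists x m,
    [/\ [/\ b <= x, x < delta, i < cf x & Dall x],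
      nu < cf x, m < cf x, forall y, y < x -> t (C delta `&` below y) <= m & V x].
  move=> bd il; have [a Ca ba] := Ccof _ bd.
  have [j jl ij] := @lt_limit (Order.max i nu) ltac:(by rewrite gt_max il).
  have [j' Lj' jj'] := Lcof _ jl.
  have [_ [x [m [[ax xd j'x Dx] mx tm xV]]]] := sP (a, j') (Cd _ Ca) (Ll _ Lj').
  move: ij; rewrite gt_max => /andP[ij nuj].
  have jx : j <= cf x by exact: le_trans j'x.
  exists x, m; split=> //; last 2 first.
  - exact: lt_le_trans jx.
  - by apply: xV => //; apply/ltW/xi_s; exists a => //; exists j'.
  by split=> //; [exact: le_trans ax|exact: lt_le_trans jx].
have V_cof : cofinal_in delta V.
  split=> // b bd; have [x [m [[bx _ _ _] _ _ _ Vx]]] := VP b (cf l) bd cf_l.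
  by exists x.
have V_card m x : nu <= m -> (forall y, y < x -> t (C delta `&` below y) <= m) ->
    V `&` below x #<= below m.
  move=> nu_m tm; apply: (card_walk_set T_wo C_club C_cf) => //.
    exact: infinite_below_le nu_m _.
  by apply: le_trans nu_m; rewrite le_max lexx.
have V_l : embeds V l.
  apply: embeds_of_segments => // x /Vlt xd.
  have [m ml tm] := t_small _ xd; exists (Order.max nu m).
    by apply: l_card; rewrite gt_max nu_l.
  apply: V_card => [|y /tm]; first by rewrite le_max lexx.
  by move=> tym; rewrite le_max tym orbT.
rewrite /walk_sequence; case: pselect => [?|[]//] i il.
set G := _ `&` _ `&` _.
have G_delta : G `<=` below delta by move=> x [[[/Vlt]]].
have <- : G `&` below delta = G by apply/setIidPl.
apply/supremums_limP; first by case: deltaL.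
split=> [|b bd]; first by case: deltaL.
have /limit_ordP[_ /(_ _ bd)[b' _ [bb' b'd]]] := deltaL.
have [x [m [[b'x xd ix Dx] nux mx tm Vx]]] := VP b' i b'd il.
exists x; last by split=> //; exact: lt_le_trans b'x.
split; last by split; [exact: lt_trans delta_k|exact: ltW].
split; last exact: (DE _ _ xi_xi' xi'r _ (Dx _ xi'r)).
(* As a limit of [V], [x] would have a cofinal subset of at most [max(nu, m)] elements. *)
apply: naccP => // xV; suff : cf x <= Order.max nu m by rewrite leNgt gt_max nux mx.
apply: (@cf_le_card _ _ T_wo x (V `&` below x)).
  by split=> [y []//|c /xV.2[y Vy [cy yx]]]; exists y => //; exact: ltW.
apply: V_card => [|y /tm]; first by rewrite le_max lexx.
by move=> tym; rewrite le_max tym orbT.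
Qed.

Lemma below_cf_otp x : x < delta -> otp l (C delta `&` below x) < cf delta.
Proof.
move=> xd; have [_ [_ /(_ _ xd)[c Cc xc]]] := C_club delta_k.
have [_ oC] := otp_embeds T_wo l (C_cf delta_k).
apply: lt_le_trans oC; apply: le_lt_trans (otp_seg_lt T_wo l (C_cf delta_k) Cc).
apply: (otpS T_wo l (b := cf delta)).
  by move=> y [Cy yx]; split=> //; exact: lt_le_trans xc.
by apply: embedsS (C_cf delta_k) => y [].
Qed.

Lemma otp_seg_unbounded j : j < cf delta ->
  exists2 x, x < delta & j <= otp l (C delta `&` below x).
Proof.
move=> jcf; apply: contrapT => nx.
have [_ Ccof] := C_club delta_k.
suff /embeds_card : embeds (C delta) j.
  by move=> /(cf_le_card T_wo Ccof); rewrite leNgt jcf.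
exists (fun x => otp l (C delta `&` below x)); split=> [x Cx|x y /set_mem Cx _].
  rewrite ltNge; apply/negP => jx; apply: nx; exists x => //.
  exact: (C_below C_club delta_k).
exact: (otp_seg_homo T_wo l (C_cf delta_k)).
Qed.

(** Since [cf delta = cf l], the threshold [t] tends to [l] along [delta]. A point [sigma] with
    [cf sigma > cf delta] is not a limit of [C delta], so [t] is constant just below [sigma], and
    targets of cofinality beyond that constant can be taken there. *)
Lemma positional_reaches (lam : T -> T) (L : set T) :
  cf delta = cf l -> cofinal_in l L -> increasing_enum lam (cf l) L ->
  (forall b nu, b < delta -> nu < l -> exists2 sigma,
    high_below nu b sigma & forall c nu', c < sigma -> nu' < l ->
      exists tau, [/\ Dall tau, c < tau, tau < sigma & nu' < cf tau]) ->
  let t A := lam (otp l A) in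
  (forall x, x < delta -> exists2 m, m < l &
    forall y, y < x -> t (C delta `&` below y) <= m) /\
  (forall b i, b < delta -> i < l -> reaches t b i).
Proof.
move=> cfE [Ll Lcof] [[lamL _ lam_surj] lam_incr] high t.
have lam_lt j : j < cf l -> lam j < l by move=> /lamL/Ll.
have lam_le i j : i <= j -> j < cf l -> lam i <= lam j.
  rewrite le_eqVlt => /predU1P[->//|ij] jcf; apply/ltW/lam_incr => //; apply: mem_set => //.
  exact: lt_trans jcf.
have otp_cf x : x < delta -> otp l (C delta `&` below x) < cf l.
  by rewrite -cfE; exact: below_cf_otp.
have otp_le x y : x <= y -> otp l (C delta `&` below x) <= otp l (C delta `&` below y).
  move=> xy; apply: (otpS T_wo l (b := cf delta)).
    by move=> z [Cz zx]; split=> //; exact: lt_le_trans xy.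
  by apply: embedsS (C_cf delta_k) => z [].
have t_le x y : x <= y -> y < delta -> t (C delta `&` below x) <= t (C delta `&` below y).
  by move=> xy yd; apply: lam_le (otp_le _ _ xy) (otp_cf _ yd).
split=> [x xd|b i bd il].
  exists (t (C delta `&` below x)); first exact/lam_lt/otp_cf.
  by move=> y /ltW yx; exact: t_le.
have [_ /lam_surj[j0 j0cf <-] i_j0] := Lcof _ il.
have [a1 a1d j0a1] : exists2 x, x < delta & j0 <= otp l (C delta `&` below x).
  by apply: otp_seg_unbounded; rewrite cfE.
have [||sigma [a2s [sd cfs]] sigma_high] := high (Order.max b a1) (cf delta).
- by rewrite gt_max bd.
- exact: cf_lt_singular.
move: a2s; rewrite gt_max => /andP[bs a1s].
have Cnlim : ~ lim_of (C delta) sigma.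
  move=> Clim; suff : cf sigma <= cf delta by rewrite leNgt cfs.
  apply: (@cf_le_card _ _ T_wo _ (C delta `&` below sigma)).
    by split=> [y []//|c /Clim.2[y Cy [cy ys]]]; exists y => //; exact: ltW.
  by apply: card_le_trans (embeds_card (C_cf delta_k)); apply: subset_card_le => y [].
have [|y ys Cy] := lim_ofN _ Cnlim; first by exists b.
set s := t (C delta `&` below sigma).
have sl : s < l by exact/lam_lt/otp_cf.
(* [s'] is the successor of [s], so that a threshold [h < s'] satisfies [h <= s]. *)
have [s' s's s'min] := @least_exists _ _ T_wo [set z | s < z] ltac:(by exists l).
have s'l : s' < l by have [j jl /s'min/le_lt_trans] := lt_limit sl; apply.
have [||tau [Dtau ytau taus cftau]] := sigma_high (Order.max y b) s'.
- by rewrite gt_max ys.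
- exact: s'l.
move: ytau; rewrite gt_max => /andP[ytau btau].
have CE : C delta `&` below tau = C delta `&` below sigma.
  by apply: gap_below (ltW taus) _ => c Cc cs; exact: le_lt_trans (Cy _ Cc cs) _.
have taud := lt_trans taus sd.
have [|x [taux xd s'x Dx [CE' [h hs' [xi0 xi0r xw]]]]] :=
  walk_set_stable Dtau (ltW cftau) _ delta_k taud; first by exists s.
have sx : s < cf x by exact: lt_le_trans s'x.
exists x, s; split=> //.
- split=> //; first exact: le_trans (ltW btau) taux.
  apply: le_trans i_j0 _; apply: le_trans (ltW sx).
  by apply: lam_le (otp_cf _ sd); apply: le_trans j0a1 _; exact/otp_le/ltW.
- by move=> z zx; rewrite /s -CE -CE'; apply: t_le => //; exact: ltW.
exists xi0 => // xi xi0xi xir; apply: xw => //; rewrite CE -/s leNgt; apply/negP => sh.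
by have := s'min _ sh; rewrite leNgt hs'.
Qed.

(** First each [b] gets a threshold good for all [i < l], then one threshold is found for all
    [b]. *)
Lemma constant_reaches :
  cf delta <> cf l ->
  (forall b nu, b < delta -> nu < l ->
    exists tau, [/\ Dall tau, b < tau, tau < delta & nu < cf tau]) ->
  exists2 h, h < l & forall b i, b < delta -> i < l -> reaches (fun=> h) b i.
Proof.
move=> cfN high.
have [_ [Cd Ccof]] := C_club delta_k.
pose P b h := forall i, i < l -> exists x, [/\ b <= x, x < delta, i <= cf x, Dall x &
  exists2 xi0, xi0 < rho & forall xi, xi0 <= xi -> xi < rho ->
    walk_set C (Dseq xi) (fun=> h) delta x].
have P_le b b' h h' : b' <= b -> h <= h' -> P b h -> P b' h'.
  move=> b'b hh' Ph i /Ph[x [bx xd ix Dx [xi0 xi0r xw]]]; exists x; split=> //.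
    exact: le_trans bx.
  exists xi0 => // xi xi0xi xir; have [c xc cx] := xw _ xi0xi xir.
  by exists c => //; exact: walk_mono cx.
have wl : w < l by exact: lt_trans cf_l.
have P_ex b : b < delta -> exists2 h, h < l & P b h.
  move=> bd; apply: contrapT => nP.
  have /choice[f fP] : forall h, exists j, h < l -> [/\ h < j, j < l & ~ exists x,
      [/\ b <= x, x < delta, j <= cf x, Dall x &
       exists2 xi0, xi0 < rho & forall xi, xi0 <= xi -> xi < rho ->
         walk_set C (Dseq xi) (fun=> h) delta x]].
    move=> h; have [hl|nhl] := pselect (h < l); last by exists h.
    have [j [jl nj]] : exists j, j < l /\ ~ exists x,
        [/\ b <= x, x < delta, j <= cf x, Dall x &
         exists2 xi0, xi0 < rho & forall xi, xi0 <= xi -> xi < rho ->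
           walk_set C (Dseq xi) (fun=> h) delta x].
      apply: contrapT => nj; apply: nP; exists h => // j jl.
      by apply: contrapT => njx; apply: nj; exists j.
    have [j' j'l jj'] := @lt_limit (Order.max h j) ltac:(by rewrite gt_max hl).
    move: jj'; rewrite gt_max => /andP[hj' jj'].
    exists j' => _; split=> // -[x [bx xd j'x Dx xw]]; apply: nj; exists x; split=> //.
    exact: le_trans (ltW jj') j'x.
  (* [f h] is an index at which [h] fails, and [i] is closed under [f] in the sense of [iP]. The
     threshold [h < i] obtained for [i] is at most some [e] with [f e < i], contradicting the
     failure of [e] at [f e]. *)
  have [|i [wi il] iP] := sup_iterates T_wo w_inf w_cf _ wl (f := f).
    by move=> h /fP[].
  have [tau [Dtau btau taud itau]] := high _ _ bd il.
  have [|x [taux xd ix Dx [CE [h hi [xi0 xi0r xw]]]]] :=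
    walk_set_stable Dtau (ltW itau) _ delta_k taud; first by exists w.
  have [e [he _ ei fei]] := iP _ hi; have [_ _] := fP _ (lt_trans ei il); apply.
  exists x; split=> //; [exact: le_trans (ltW btau) taux|exact: le_trans (ltW fei) ix|].
  by exists xi0 => // xi xi0xi xir; exact: xw.
suff [h hl hP] : exists2 h, h < l & forall b, b < delta -> P b h.
  exists h => // b i bd il.
  have [j jl] := @lt_limit (Order.max i h) ltac:(by rewrite gt_max il).
  rewrite gt_max => /andP[ij hj].
  have [x [bx xd jx Dx xw]] := hP _ bd _ jl; exists x, h; split=> //.
    by split=> //; exact: le_trans (ltW ij) jx.
  exact: lt_le_trans jx.
(* Without a uniform threshold, [g] (a place where [h] fails) and [f] (a threshold good at [b])
   carry cofinal sets of [l] and [delta] to cofinal sets of each other, forcing equal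
   cofinalities. *)
apply: contrapT => nh; apply: cfN.
have /choice[g gP] : forall h, exists b, h < l -> b < delta /\ ~ P b h.
  move=> h; have [hl|nhl] := pselect (h < l); last by exists h.
  apply: contrapT => nb; apply: nh; exists h => // b bd.
  by apply: contrapT => nPb; apply: nb; exists b.
have /choice[f fP] : forall b, exists h, b < delta -> h < l /\ P b h.
  move=> b; have [/P_ex[h hl Ph]|nbd] := pselect (b < delta); first by exists h.
  by exists b.
have [L [Ll Lcof] /embeds_card Lcf] := embeds_cf_cofinal T_wo l.
apply/eqP; rewrite eq_le; apply/andP; split.
  apply: (@cf_le_card _ _ T_wo _ (g @` L)); last first.
    exact: card_le_trans (card_image_le _ _) Lcf.
  split=> [_ [h /Ll/gP[gd _] <-] //|b bd]; have [fl Pf] := fP _ bd.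
  have [h Lh fh] := Lcof _ fl; have [gd ngP] := gP _ (Ll _ Lh).
  exists (g h); first by exists h.
  by rewrite leNgt; apply/negP => gb; apply: ngP; apply: P_le Pf => //; exact: ltW.
apply: (@cf_le_card _ _ T_wo _ (f @` C delta)).
  split=> [_ [b /Cd/fP[fl _] <-] //|h hl]; have [gd ngP] := gP _ hl.
  have [b Cb gb] := Ccof _ gd; have [fl Pf] := fP _ (Cd _ Cb).
  exists (f b); first by exists b.
  by rewrite leNgt; apply/negP => fh; apply: ngP; apply: P_le Pf => //; exact: ltW.
exact: card_le_trans (card_image_le _ _) (embeds_card (C_cf delta_k)).
Qed.

End Stabilization.

End Guessing.

(** * The decreasing sequence of clubs and the final contradiction *)

Lemma infinite_limit_ord (d : Order.disp_t) (T : orderType d) (a : T) :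
  limit_ord a -> infinite_set (below a).
Proof.
move=> /limit_ordP[[x0 x0a] aL].
have /choice[f fP] : forall x, exists y, x < a -> x < y /\ y < a.
  move=> x; have [/aL[y _ xy]|nxa] := pselect (x < a); first by exists y.
  by exists x.
have fa n : iter n f x0 < a by elim: n => //= n /fP[].
have f_homo : {homo (fun n => iter n f x0) : m n / (m < n)%N >-> m < n}.
  by apply: homo_ltn => [y x z|n]; [exact: lt_trans|have [] := fP _ (fa n)].
apply/infiniteP; apply: (@card_le_inj _ _ _ _ (fun n => iter n f x0)) => [n _|m n _ _ E].
  exact: fa.
by have [/f_homo|/f_homo|//] := ltngtP m n; rewrite E ltxx.
Qed.

(** By recursion, [D xi] is the intersection of all [F (D xi')] with [xi' < xi], an intersection of
    at most [l] clubs. *)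
Lemma decreasing_clubs (d : Order.disp_t) (T : orderType d)
    (T_wo : wochoice.well_order (<=%O : rel T)) (l k : T)
    (F : set T -> set T) : infinite_set (below l) -> is_succ_cardinal l k ->
  (forall D, club_in k D -> club_in k (F D)) ->
  exists D : T -> set T,
    [/\ forall xi, xi <= l -> club_in k (D xi),
        forall xi xi', xi <= xi' -> D xi' `<=` D xi &
        forall xi xi', xi < xi' -> D xi' `<=` F (D xi)].
Proof.
move=> l_inf kP F_club.
have [D DE] := @wf_rec_ex T (set T) _ set0 (fun xi f =>
  below k `&` \bigcap_(xi' in below xi) F (f xi')) (lt_wf T_wo).
have {}DE xi : D xi = below k `&` \bigcap_(xi' in below xi) F (D xi').
  rewrite DE; congr (_ `&` _); apply: eq_bigcapr => xi' xi'xi.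
  by case: pselect.
exists D; split.
- elim/(lt_ind T_wo) => xi IH xil; rewrite DE.
  apply: (club_bigcap T_wo l_inf kP) => [|xi' xi'xi].
    by apply: subset_card_le => x /lt_le_trans; apply.
  by apply/F_club/IH => //; apply: ltW; exact: lt_le_trans xil.
- move=> xi xi' xixi' x; rewrite !DE => -[xk xF]; split=> // z zxi.
  by apply: xF; exact: lt_le_trans xixi'.
by move=> xi xi' xixi' x; rewrite DE => -[_]; apply.
Qed.

Theorem theorem3p23 (d : Order.disp_t) (T : orderType d)
    (T_wo : wochoice.well_order (<=%O : rel T))
    (lambda lambda_plus : T)
    (lambda_sing : singular lambda)
    (lambda_cf : gt_omega (cf lambda))
    (lambda_plusP : is_succ_cardinal lambda lambda_plus)
    (lambda_square : weak_square lambda lambda_plus)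
    (lambda_ : T -> T) (L : set T)
    (L_club : club_in lambda L)
    (L_enum : increasing_enum lambda_ (cf lambda) L)
    (S : set T)
    (S_cf : S `<=` E_gt_omega lambda_plus)
    (S_stat : stationary_in lambda_plus S) :
  exists C : T -> set T,
    weak_square_transversal lambda lambda_plus C /\
    forall D : set T, club_in lambda_plus D ->
      exists2 delta, S delta &
        forall i, i < Order.min delta (cf lambda) ->
          supremums (nacc (C delta) `&` D `&` E_ge lambda_plus (lambda_ i))
            delta.
Proof.
have [l_card l_inf cf_l] := lambda_sing.
have [w [/infinite_limit_ord w_inf _] w_cf] := lambda_cf.
have wl : w < lambda by exact: lt_trans cf_l.
have [_ L_cof] := L_club.
have [C [C_club C_cf C_coh]] := weak_square_thin T_wo lambda_sing lambda_plusP lambda_square.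
pose F := walk_sequence lambda C.
apply: contrapT => noC.
(* [E (D, t)] is a club not guessed by the walk sequence of [D] and [t] at any [delta] in [S]. *)
have /choice[E EP] : forall p : set T * (set T -> T), exists E, club_in lambda_plus p.1 ->
    club_in lambda_plus E /\ forall delta, S delta -> exists2 i, i < lambda &
      ~ supremums (nacc (F p.1 p.2 delta) `&` E `&` E_ge lambda_plus i) delta.
  move=> [D t] /=; have [Dclub|nD] := pselect (club_in lambda_plus D); last by exists set0.
  apply: contrapT => nE; apply: noC; exists (F D t); split.
    exact: walk_sequence_transversal.
  move=> E Eclub; apply: contrapT => nS; apply: nE; exists E => _; split=> // delta Sd.
  apply: contrapT => ni; apply: nS; exists delta => // i.
  rewrite lt_min => /andP[_ icf]; apply: contrapT => nsup; apply: ni.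
  exists (lambda_ i) => //; have [[lamL _ _] _] := L_enum.
  by have [Ll _] := L_cof; apply: Ll; exact: lamL.
pose pos A := lambda_ (otp lambda A).
(* The threshold function is chosen only once [delta] is known, so [next] takes in the unguessed
   clubs for [pos] and for every constant below [lambda] at once. *)
pose next D := D `&` (E (D, pos) `&`
  (below lambda_plus `&` \bigcap_(h in below lambda) E (D, fun=> h))).
have next_club D : club_in lambda_plus D -> club_in lambda_plus (next D).
  move=> Dclub; apply: (club_setI T_wo l_inf lambda_plusP) => //.
  apply: (club_setI T_wo l_inf lambda_plusP).
    by have [] := EP (D, pos) Dclub.
  apply: (club_bigcap T_wo l_inf lambda_plusP); first exact: card_lexx.
  by move=> h _; have [] := EP (D, fun=> h) Dclub.
have [Ds [Ds_club Ds_le Ds_next]] := decreasing_clubs T_wo l_inf lambda_plusP next_club.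
have hl_club := club_high_limits T_wo l_card l_inf lambda_plusP w_inf wl.
(* The outer [high_limits] provides the points [sigma] below [delta], the inner one the targets
   [tau] below each [sigma]. *)
have [delta [Sd [dk d_high]]] := S_stat.2 _ (hl_club _ (hl_club _ (Ds_club _ (lexx _)))).
pose nu := Order.max (cf delta) (Order.max (cf lambda) w).
have nu_inf : infinite_set (below nu).
  by apply: infinite_below_le w_inf; rewrite !le_max lexx !orbT.
have cfd : cf delta < lambda by exact: (cf_lt_singular T_wo lambda_sing lambda_plusP).
(* [rho <= lambda] keeps [Ds lambda] inside every [Ds xi] with [xi < rho], while [cf rho] exceeds
   the number of requests. *)
have [rho rho_l] := exists_cf_gt T_wo l_card nu_inf
  ltac:(by rewrite !gt_max cfd cf_l).
rewrite !gt_max => /and3P[d_rho l_rho w_rho].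
have rho0 : below rho !=set0.
  by exists (cf delta); apply: lt_le_trans d_rho _; apply: cf_le => //; exact: card_lexx.
have Ds_clubr xi : xi < rho -> club_in lambda_plus (Ds xi).
  by move=> xir; apply: Ds_club; exact: le_trans (ltW xir) rho_l.
have Dall x xi : Ds lambda x -> xi < rho -> Ds xi x.
  move=> Dx xir; apply: Ds_le Dx; exact: le_trans (ltW xir) rho_l.
have d_lim nu' : nu' < lambda -> limit_ord delta.
  by move=> /d_high; move=> dlim; apply/limit_ordP; apply: lim_ofS dlim.
have dL := d_lim _ wl.
have high2 b nu' : b < delta -> nu' < lambda -> exists2 sigma,
    high_below delta nu' b sigma & forall c nu'', c < sigma -> nu'' < lambda ->
      exists tau, [/\ forall xi, xi < rho -> Ds xi tau, c < tau, tau < sigma & nu'' < cf tau].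
  move=> bd nu'l; have [_ /(_ _ bd)[s [[sk s_high] scf] [bs sd]]] := d_high _ nu'l.
  exists s => // c nu'' cs nu''l.
  have [_ /(_ _ cs)[tau [Dtau cftau] [ctau taus]]] := s_high _ nu''l.
  by exists tau; split=> // xi; exact: Dall.
suff [t [t_small t_reaches t_next]] : exists t,
    [/\ forall x, x < delta -> exists2 m, m < lambda &
          forall y, y < x -> t (C delta `&` below y) <= m,
        forall b i, b < delta -> i < lambda -> reaches C rho Ds delta t b i &
        forall D, next D `<=` E (D, t)].
  have [|xi xir xi_sup] := walk_sequence_guesses T_wo lambda_sing lambda_plusP
    C_club C_cf w_inf w_cf dk (E := fun xi => E (Ds xi, t)) d_rho l_rho w_rho dL
    t_small t_reaches.
    by move=> xi xi' xixi' _ x /(Ds_next _ _ xixi')/t_next.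
  have [_ /(_ _ Sd)[i il]] := EP (Ds xi, t) (Ds_clubr _ xir).
  by apply; exact: xi_sup.
have [cfE|cfN] := pselect (cf delta = cf lambda).
  exists pos; have [] := positional_reaches T_wo lambda_sing lambda_plusP C_club C_cf
    rho0 Ds_clubr Ds_le w_inf w_cf dk cfE L_cof L_enum high2.
  by split=> // D x [_ []].
have [|h hl h_reaches] := constant_reaches T_wo lambda_sing lambda_plusP C_club C_cf
    rho0 Ds_clubr Ds_le w_inf w_cf dk cfN.
  move=> b nu' bd nu'l; have [s [bs [sd _]] s_high] := high2 b nu' bd nu'l.
  have [tau [Dtau btau taus cftau]] := s_high _ _ bs nu'l.
  by exists tau; split=> //; exact: lt_trans sd.
exists (fun=> h); split=> // [x xd|D x [_ [_ [_ /(_ _ hl)]]]] //.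
by exists h.
Qed.
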